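(* Let $(X,\phi)$ be a non-compact, connected calibrated manifold. Every compact $\phi$-submanifold $M\subset X$ (without boundary) is contained in the inner core of $X$.
   Context: A calibrated manifold $(X,\phi)$ of degree $p\ge 1$ is a smooth riemannian manifold $X$ together with a closed smooth $p$-form $\phi$ such that $\phi(\xi)\le 1$ for every unit simple tangent $p$-vector $\xi$ on $X$. $G(\phi)$ denotes the set of unit simple tangent $p$-vectors $\xi$ with $\phi(\xi)=1$ ($\phi$-planes). A $\phi$-submanifold is an oriented $p$-dimensional submanifold whose oriented unit tangent $p$-vector at each point belongs to $G(\phi)$. For $f\in C^\infty(X)$, the $\phi$-Hessian of $f$ is the $p$-form $\mathcal H^\phi(f)(v_1,\dots,v_p)=\sum_{i=1}^p\phi(v_1,\dots,\nabla_{v_i}(\nabla f),\dots,v_p)$ ($\nabla_{v_i}(\nabla f)$ in the $i$-th slot, $\nabla$ the Levi-Civita connection). $\mathcal{PSH}(X,\phi)$ is the set of $f\in C^\infty(X)$ with $\mathcal H^\phi(f)(\xi)\ge 0$ for all $\xi\in G(\phi)$. The inner core of $X$ is the set of points $x\in X$ for which there exists $y\in X$, $y\ne x$, with $f(x)=f(y)$ for all $f\in\mathcal{PSH}(X,\phi)$. *)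

(* Defs.v *)
From HB Require Import structures.
From mathcomp Require Import all_boot all_order all_algebra.
From mathcomp Require Import all_classical all_reals all_analysis.
From mathcomp Require Import ring.

Set Implicit Arguments.
Unset Strict Implicit.
Unset Printing Implicit Defensive.

Import Order.TTheory GRing.Theory Num.Theory.
Import numFieldNormedType.Exports.

Local Open Scope classical_set_scope.
Local Open Scope ring_scope.

(* Conventions. The model space is 'rV[R]_n; vectors are rows, so a
   differential acts by right multiplication with the Jacobian matrix 'J f x
   and a Gram matrix G gives the inner product <v, w> = v *m G *m w^T. A tuple
   (v_1, .., v_p) of vectors is the matrix W : 'M_(p, n) whose rows are the
   v_i. A tensor field on a manifold is given by its component expressions in
   the charts of the atlas, subject to the tensor transformation law. *)

Section Calculus.
Variable R : realType.

Fixpoint Ck (k : nat) (V W : normedModType R) (U : set V) (f : V -> W) : Prop :=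
  if k is k'.+1 then
    (forall x, U x -> differentiable f x) /\
    (forall v : V, Ck k' U (fun x => 'D_v f x))
  else forall x, U x -> {for x, continuous f}.

(* Meaningful for open U: only the germs of f at the points of U matter. *)
Definition smooth_on (V W : normedModType R) (U : set V) (f : V -> W) : Prop :=
  forall k, Ck k U f.

End Calculus.

Section RowOperations.
Variables (R : realType) (p n : nat).

Definition set_row (i : 'I_p) (v : 'rV[R]_n) (W : 'M[R]_(p, n)) : 'M[R]_(p, n) :=
  \matrix_(j < p) (if j == i then v else row j W).

Definition multilinear (w : 'M[R]_(p, n) -> R) : Prop :=
  forall (i : 'I_p) (a : R) (u v : 'rV[R]_n) (W : 'M[R]_(p, n)),
    w (set_row i (a *: u + v) W) = a * w (set_row i u W) + w (set_row i v W).

Definition alternate (w : 'M[R]_(p, n) -> R) : Prop :=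
  forall (W : 'M[R]_(p, n)) (i j : 'I_p),
    i != j -> row i W = row j W -> w W = 0.

End RowOperations.

Section LocalGeometry.
Variables (R : realType) (n : nat).
Implicit Types (G : 'rV[R]_n -> 'M[R]_n) (x v : 'rV[R]_n).

Definition partial_at (i : 'I_n) (f : 'rV[R]_n -> R) x : R :=
  'D_(delta_mx 0 i) f x.

(* Gamma_{ij}^k of the Levi-Civita connection of the metric G; see
   [christoffel_torsion_free] and [christoffel_metric] below. *)
Definition christoffel G x (i j k : 'I_n) : R :=
  2^-1 * \sum_(l < n) invmx (G x) k l *
    (partial_at i (fun y => G y j l) x + partial_at j (fun y => G y i l) x
     - partial_at l (fun y => G y i j) x).

Definition covariant_derivative G v (Y : 'rV[R]_n -> 'rV[R]_n) x : 'rV[R]_n :=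
  'D_v Y x +
  \row_(k < n) \sum_(i < n) \sum_(j < n) christoffel G x i j k * v 0 i * Y x 0 j.

Definition gradient G (f : 'rV[R]_n -> R) x : 'rV[R]_n :=
  \row_(k < n) \sum_(l < n) invmx (G x) k l * partial_at l f x.

Definition exterior_derivative (p : nat) (w : 'rV[R]_n -> 'M[R]_(p, n) -> R) x
    (W : 'M[R]_(p.+1, n)) : R :=
  \sum_(i < p.+1) (-1) ^+ i * 'D_(row i W) (fun y => w y (row' i W)) x.

(* The squared norm |v_1 /\ .. /\ v_p|^2 = det (<v_i, v_j>), at a point where
   the Gram matrix of the metric is g. *)
Definition sqnorm_simple (g : 'M[R]_n) (p : nat) (W : 'M[R]_(p, n)) : R :=
  \det (W *m g *m W^T).

Definition phi_hessian (p : nat) G (w : 'rV[R]_n -> 'M[R]_(p, n) -> R)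
    (f : 'rV[R]_n -> R) x (W : 'M[R]_(p, n)) : R :=
  \sum_(i < p)
    w x (set_row i (covariant_derivative G (row i W) (gradient G f) x) W).

Lemma partial_metricC G (U : set 'rV[R]_n) x (i j k : 'I_n) :
  open U -> (forall y, U y -> (G y)^T = G y) -> U x ->
  partial_at k (fun y => G y i j) x = partial_at k (fun y => G y j i) x.
Proof.
move=> oU sG Ux; apply: near_eq_derive.
have : nbhs x U by exact: open_nbhs_nbhs.
by apply: filterS => y Uy; rewrite -{1}(sG y Uy) mxE.
Qed.

Lemma christoffel_torsion_free G (U : set 'rV[R]_n) x (i j k : 'I_n) :
  open U -> (forall y, U y -> (G y)^T = G y) -> U x ->
  christoffel G x i j k = christoffel G x j i k.
Proof.
move=> oU sG Ux; rewrite /christoffel; congr (_ * _).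
apply: eq_bigr => l _; congr (_ * _).
by rewrite (partial_metricC i j l oU sG Ux) [X in X - _ = _]addrC.
Qed.

Lemma christoffel_lower G x (i j m : 'I_n) : G x \in unitmx ->
  \sum_(l < n) christoffel G x i j l * G x m l =
  2^-1 * (partial_at i (fun y => G y j m) x + partial_at j (fun y => G y i m) x
          - partial_at m (fun y => G y i j) x).
Proof.
move=> uG; set K := fun l : 'I_n =>
  partial_at i (fun y => G y j l) x + partial_at j (fun y => G y i l) x
  - partial_at l (fun y => G y i j) x.
transitivity (2^-1 * \sum_(q < n) (\sum_(l < n) G x m l * invmx (G x) l q) * K q).
  transitivity (\sum_(l < n) \sum_(q < n) 2^-1 * (G x m l * invmx (G x) l q * K q)).
    apply: eq_bigr => l _; rewrite /christoffel -/K -mulrA mulr_suml mulr_sumr.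
    by apply: eq_bigr => q _; congr (_ * _); rewrite mulrAC [_ * G x m l]mulrC.
  rewrite exchange_big mulr_sumr; apply: eq_bigr => q _.
  by rewrite mulr_suml mulr_sumr.
have GV q : \sum_(l < n) G x m l * invmx (G x) l q = (m == q)%:R.
  by have := congr1 (fun A : 'M[R]_n => A m q) (mulmxV uG); rewrite !mxE.
congr (_ * _); under eq_bigr => q _ do rewrite GV.
rewrite (bigD1 m) //= eqxx mul1r big1 ?addr0 // => q qm.
by rewrite eq_sym (negbTE qm) mul0r.
Qed.

Lemma christoffel_metric G (U : set 'rV[R]_n) x (i j k : 'I_n) :
  open U -> (forall y, U y -> (G y)^T = G y) -> U x -> G x \in unitmx ->
  partial_at k (fun y => G y i j) x =
  \sum_(l < n) (christoffel G x k i l * G x l j + christoffel G x k j l * G x i l).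
Proof.
move=> oU sG Ux uG; rewrite big_split /= christoffel_lower //.
rewrite (eq_bigr (fun l => christoffel G x k i l * G x j l)); last first.
  by move=> l _; rewrite -{1}(sG x Ux) mxE.
rewrite christoffel_lower //.
rewrite (partial_metricC j i k oU sG Ux).
by field.
Qed.

End LocalGeometry.

Section Manifolds.
Variable R : realType.

(* [cinv] matters only on the open set [cimg c]. *)
Record chart (X : topologicalType) (n : nat) := Chart {
  cdom : set X;
  cmap : X -> 'rV[R]_n;
  cinv : 'rV[R]_n -> X;
  cdom_open : open cdom;
  cimg_open : open (cmap @` cdom);
  cmapK : forall x, cdom x -> cinv (cmap x) = x;
  cmap_continuous : forall x, cdom x -> {for x, continuous cmap};
  cinv_continuous : forall u, (cmap @` cdom) u -> {for u, continuous cinv} }.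

Definition cimg (X : topologicalType) (n : nat) (c : chart X n) : set 'rV[R]_n :=
  cmap c @` cdom c.

Definition overlap (X : topologicalType) (n : nat) (c c' : chart X n) :
    set 'rV[R]_n :=
  cmap c @` (cdom c `&` cdom c').

Definition transition (X : topologicalType) (n : nat) (c c' : chart X n) :
    'rV[R]_n -> 'rV[R]_n :=
  cmap c' \o cinv c.

Record manifold (n : nat) := Manifold {
  carrier :> topologicalType;
  atlas : set (chart carrier n);
  manifold_hausdorff : hausdorff_space carrier;
  manifold_second_countable : @second_countable carrier;
  atlas_cover : forall x : carrier, exists2 c, atlas c & cdom c x;
  atlas_smooth : forall c c', atlas c -> atlas c' ->
    smooth_on (overlap c c') (transition c c') }.

Record riemannian_manifold (n : nat) := RiemannianManifold {
  rm_manifold :> manifold n;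
  metric : chart rm_manifold n -> 'rV[R]_n -> 'M[R]_n;
  metric_smooth : forall c, atlas c -> smooth_on (cimg c) (metric c);
  metric_sym : forall c u, atlas c -> cimg c u -> (metric c u)^T = metric c u;
  metric_pos : forall c u, atlas c -> cimg c u ->
    forall v : 'rV[R]_n, v != 0 -> 0 < (v *m metric c u *m v^T) 0 0;
  metric_transform : forall c c', atlas c -> atlas c' ->
    forall u, overlap c c' u ->
      metric c u =
      'J (transition c c') u *m metric c' (transition c c' u)
        *m ('J (transition c c') u)^T }.

Record calibrated_manifold (n p : nat) := CalibratedManifold {
  cm_manifold :> riemannian_manifold n;
  phi : chart cm_manifold n -> 'rV[R]_n -> 'M[R]_(p, n) -> R;
  calibration_degree : (1 <= p)%N;
  phi_multilinear : forall c u, atlas c -> cimg c u -> multilinear (phi c u);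
  phi_alternate : forall c u, atlas c -> cimg c u -> alternate (phi c u);
  phi_smooth : forall c W, atlas c -> smooth_on (cimg c) (fun u => phi c u W);
  phi_transform : forall c c', atlas c -> atlas c' ->
    forall u W, overlap c c' u ->
      phi c u W =
      phi c' (transition c c' u) (W *m 'J (transition c c') u);
  phi_closed : forall c u W, atlas c -> cimg c u ->
    exterior_derivative (phi c) u W = 0;
  phi_comass : forall c u W, atlas c -> cimg c u ->
    sqnorm_simple (metric c u) W = 1 -> phi c u W <= 1 }.

End Manifolds.

Section Plurisubharmonic.
Variables (R : realType) (n p : nat) (X : calibrated_manifold R n p).

(* The simple p-vector with factors the rows of W, based at the point of
   coordinates u in the chart c, belongs to G(phi). *)
Definition phi_plane (c : chart R X n) (u : 'rV[R]_n) (W : 'M[R]_(p, n)) : Prop :=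
  sqnorm_simple (metric c u) W = 1 /\ phi c u W = 1.

Definition smooth_function (f : X -> R) : Prop :=
  forall c : chart R X n, atlas c -> smooth_on (cimg c) (f \o cinv c).

Definition PSH : set (X -> R) :=
  [set f | smooth_function f /\
    forall (c : chart R X n) u W, atlas c -> cimg c u -> phi_plane c u W ->
      0 <= phi_hessian (metric c) (phi c) (f \o cinv c) u W].

Definition inner_core : set X :=
  [set x | exists2 y : X, y <> x & forall f : X -> R, PSH f -> f x = f y].

End Plurisubharmonic.

Arguments inner_core {R n p} X _.
Arguments PSH {R n p} X _.

Section Submanifolds.
Variable R : realType.

Record parametrized_patch (X : Type) (p : nat) := ParametrizedPatch {
  pdom : set 'rV[R]_p;
  pparam : 'rV[R]_p -> X }.

Section Embedded.
Variables (n p : nat) (X : manifold R n).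
Implicit Types (M : set X) (a b : parametrized_patch X p).

Definition patch_at (c : chart R X n) a : set 'rV[R]_p :=
  pdom a `&` pparam a @^-1` cdom c.

(* The rows are the coordinate vector fields of the patch, read in c. *)
Definition patch_frame (c : chart R X n) a (s : 'rV[R]_p) : 'M[R]_(p, n) :=
  'J (cmap c \o pparam a) s.

(* An immersion which is a homeomorphism onto a relatively open subset of M:
   the images of open sets are relatively open in M. *)
Record local_parametrization M a : Prop := LocalParametrization {
  pdom_open : open (pdom a);
  pparam_continuous : forall s, pdom a s -> {for s, continuous (pparam a)};
  pparam_inj : {in pdom a &, injective (pparam a)};
  pparam_open : forall V : set 'rV[R]_p, open V -> V `<=` pdom a ->
    exists2 U : set X, open U & pparam a @` V = M `&` U;
  pparam_smooth : forall c, atlas c ->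
    smooth_on (patch_at c a) (cmap c \o pparam a);
  pparam_immersion : forall c s, atlas c -> patch_at c a s ->
    row_free (patch_frame c a s) }.

(* An embedded p-dimensional submanifold M without boundary, oriented by the
   family P of local parametrizations (which are the positively oriented ones):
   two of them induce the same orientation of each common tangent space. For
   p >= 1 every orientation is of this form. *)
Record oriented_submanifold M (P : set (parametrized_patch X p)) : Prop :=
    OrientedSubmanifold {
  orientation_param : forall a, P a -> local_parametrization M a;
  orientation_cover : forall x, M x ->
    exists2 a, P a & exists2 s, pdom a s & pparam a s = x;
  orientation_compat : forall a b c s t, P a -> P b -> atlas c ->
    patch_at c a s -> patch_at c b t -> pparam a s = pparam b t ->
    exists2 A : 'M[R]_p, 0 < \det A & patch_frame c a s = A *m patch_frame c b t }.

(* W represents, in the chart c, the oriented unit tangent p-vector of the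
   submanifold at pparam a s: a positively oriented frame of the tangent space,
   of unit p-volume. *)
Definition oriented_unit_tangent (g : 'M[R]_n) (c : chart R X n) a
    (s : 'rV[R]_p) (W : 'M[R]_(p, n)) : Prop :=
  sqnorm_simple g W = 1 /\
  exists2 A : 'M[R]_p, 0 < \det A & W = A *m patch_frame c a s.

End Embedded.

Definition phi_submanifold (n p : nat) (X : calibrated_manifold R n p)
    (M : set X) (P : set (parametrized_patch X p)) : Prop :=
  oriented_submanifold M P /\
  forall (a : parametrized_patch X p) (c : chart R X n) (s : 'rV[R]_p)
      (W : 'M[R]_(p, n)),
    P a -> atlas c -> patch_at c a s ->
    let u := cmap c (pparam a s) in
    oriented_unit_tangent (metric c u) c a s W -> phi_plane c u W.

End Submanifolds.

(* Main.v *)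
Require Import Defs.
From mathcomp Require Import all_boot all_order all_algebra perm.
From mathcomp Require Import all_classical all_reals all_analysis.
From mathcomp Require Import ring lra.

Set Implicit Arguments.
Unset Strict Implicit.
Unset Printing Implicit Defensive.

Import Order.TTheory GRing.Theory Num.Theory.
Import numFieldNormedType.Exports.

Local Open Scope classical_set_scope.
Local Open Scope ring_scope.

(** Restricted to a phi-submanifold [M], a phi-plurisubharmonic function [f] is
    subharmonic for the induced metric. A connected component of a compact [M]
    is compact, so [f] attains its maximum on it, and the strong maximum
    principle makes [f] constant there ([psh_constant_component]). Each component
    has positive dimension, hence contains, besides any given point [x], a
    second point [y]; this [y] does not depend on [f], so [x] is in the inner
    core.

    Subharmonicity is the identity [elliptic_phi_hessian]: on the tangent frame
    of [M] the phi-Hessian of [f] is a positive multiple of the Laplacian of the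
    restriction of [f]. It is proved in the coordinates of one chart and one
    patch, without second fundamental form, in the spirit of the formula
    d (grad f _| phi) = H^phi(f) + nabla_(grad f) phi.
    - The comass bound is attained along [M], so the squared volume minus the
      squared value of phi has a minimum at a tangent frame, and its first
      derivative there vanishes in all directions, those moving the base point
      included ([first_variation]).
    - Moving only the frame, this is the first cousin principle
      ([set_row_variation]): grad f _| phi restricts to [M] as the Hodge dual of
      the differential of the restriction of [f] ([flux_adj]).
    - Moving only the base point, it computes the derivative of phi along
      grad f, which equals the Christoffel terms of the phi-Hessian since the
      connection is metric ([christoffel_variation]).
    - Closedness of phi rewrites that derivative as a sum of derivatives along
      the tangent frame ([closed_contraction]). The phi-Hessian is thereby the
      divergence of the restricted (p-1)-form ([sum_flux_derive]), the
      derivatives of the frame cancelling by symmetry of second derivatives.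

    The strong maximum principle for a second order operator without zeroth
    order term is proved by Hopf's barrier argument ([no_touching_ball]). *)

(** * Alternating forms and positive definite matrices *)

Section SetRow.
Variables (R : realType) (p n : nat).
Implicit Types (i j : 'I_p) (u v : 'rV[R]_n) (W : 'M[R]_(p, n)).

Lemma set_rowE i v W j k : set_row i v W j k = if j == i then v 0 k else W j k.
Proof. by rewrite mxE; case: ifP => // _; rewrite mxE. Qed.

Lemma row_set_row i v W j :
  row j (set_row i v W) = if j == i then v else row j W.
Proof. by apply/rowP => k; rewrite mxE set_rowE; case: ifP => //; rewrite mxE. Qed.

Lemma set_row_id i W : set_row i (row i W) W = W.
Proof. by apply/matrixP => j k; rewrite set_rowE mxE; case: eqP => // ->. Qed.

Lemma set_rowK i u v W : set_row i u (set_row i v W) = set_row i u W.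
Proof. by apply/matrixP => j k; rewrite !set_rowE; case: eqP. Qed.

Lemma set_rowC i j u v W : i != j ->
  set_row i u (set_row j v W) = set_row j v (set_row i u W).
Proof.
move=> ij; apply/matrixP => k l; rewrite !set_rowE.
by case: (eqVneq k i) => [->|//]; rewrite (negbTE ij).
Qed.

End SetRow.

Section Multilinear.
Variables (R : realType) (p n : nat) (w : 'M[R]_(p, n) -> R).
Hypothesis wm : multilinear w.
Implicit Types (i j : 'I_p) (u v : 'rV[R]_n) (W : 'M[R]_(p, n)).

Lemma multilinear0 i W : w (set_row i 0 W) = 0.
Proof.
have := wm i 1 0 0 W; rewrite scaler0 addr0 mul1r => /eqP.
by rewrite -subr_eq subrr eq_sym => /eqP.
Qed.

Lemma multilinearZ i a v W : w (set_row i (a *: v) W) = a * w (set_row i v W).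
Proof. by have := wm i a v 0 W; rewrite addr0 multilinear0 addr0. Qed.

Lemma multilinearD i u v W :
  w (set_row i (u + v) W) = w (set_row i u W) + w (set_row i v W).
Proof. by have := wm i 1 u v W; rewrite scale1r mul1r. Qed.

Lemma multilinear_sum i (I : finType) (a : I -> R) (v : I -> 'rV[R]_n) W :
  w (set_row i (\sum_k a k *: v k) W) = \sum_k a k * w (set_row i (v k) W).
Proof.
elim/big_ind2: _ => [|x b y c <- <-|k _]; first exact: multilinear0.
- exact: multilinearD.
- exact: multilinearZ.
Qed.

Lemma multilinear_row i v W :
  w (set_row i v W) = \sum_(k < n) v 0 k * w (set_row i (delta_mx 0 k) W).
Proof. by rewrite {1}(row_sum_delta v) multilinear_sum. Qed.

Hypothesis wa : alternate w.

Lemma alternate_swap i j u v W : i != j ->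
  w (set_row i u (set_row j v W)) = - w (set_row i v (set_row j u W)).
Proof.
move=> ij; have dbl x : w (set_row i x (set_row j x W)) = 0.
  apply: (wa ij); rewrite row_set_row eqxx row_set_row.
  by rewrite eq_sym (negbTE ij) row_set_row eqxx.
apply/eqP; rewrite -addr_eq0; apply/eqP.
have := dbl (u + v); rewrite multilinearD.
rewrite ![set_row i _ (set_row j (u + v) W)]set_rowC // !multilinearD.
by rewrite ![set_row j _ (set_row i _ W)]set_rowC ?(eq_sym j i) // !dbl add0r addr0.
Qed.

Lemma alternate_tperm i j W : i != j -> w (row_perm (tperm i j) W) = - w W.
Proof.
move=> ij.
have -> : row_perm (tperm i j) W = set_row i (row j W) (set_row j (row i W) W).
  apply/matrixP => k l; rewrite !set_rowE !mxE.
  by case: tpermP => [->|->|/eqP/negbTE-> /eqP/negbTE-> //];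
    rewrite ?eqxx // eq_sym (negbTE ij).
by rewrite alternate_swap // !set_row_id.
Qed.

Lemma alternate_perm (s : 'S_p) W : w (row_perm s W) = (-1) ^+ s * w W.
Proof.
have [ts -> tsP] := prod_tpermP s.
elim: ts tsP W => [|[i j] ts IH] /= tsP W.
  by rewrite big_nil odd_perm1 expr0 mul1r row_perm1.
case/andP: tsP => /= ij tsP; rewrite big_cons row_permM alternate_tperm // IH //.
by rewrite odd_permM odd_tperm ij addTb; case: odd_perm; rewrite ?mulN1r ?mul1r ?opprK // expr1 mulN1r.
Qed.

End Multilinear.

(** Row [j] of [W] is row [j + 1] of the stacked matrix; removing it leaves the
    rows of [set_row j Y W] in an order that differs by a cycle of length
    [j + 1]. *)
Lemma alternate_row' (R : realType) p n (w : 'M[R]_(p, n) -> R)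
    (Y : 'rV[R]_n) (W : 'M[R]_(p, n)) (j : 'I_p) :
  multilinear w -> alternate w ->
  w (row' (lift ord0 j) (col_mx Y W : 'M[R]_(p.+1, n))) = (-1) ^+ j * w (set_row j Y W).
Proof.
case: p w W j => [|p] w W j wm wa; first by case: j.
have := alternate_perm wm wa (lift_perm ord0 j 1) (set_row j Y W).
rewrite odd_lift_perm odd_perm1 addbF /= signr_odd => <-; congr w.
apply/matrixP => k l; rewrite !mxE.
case: (unliftP ord0 k) => [k'|] ->.
  rewrite lift_perm_lift perm1 eq_sym (negbTE (neq_lift _ _)) mxE.
  case: splitP => m /= E; first by move: E; rewrite ord1 /bump /= !add1n addnS.
  congr (W _ _); apply: val_inj => /=.
  by move: E; rewrite /bump /= !add1n ltnS addnS => -[].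
rewrite lift_perm_id eqxx.
case: splitP => m /= E; first by rewrite ord1.
by move: E; rewrite /bump /= addn0 add1n => -[].
Qed.

Section Determinant.
Variables (R : realType) (p : nat).

Lemma det_set_row (i : 'I_p) (v : 'rV[R]_p) (g : 'M[R]_p) :
  \det (set_row i v g) = \sum_j v 0 j * \adj g j i.
Proof.
rewrite (expand_det_row _ i); apply: eq_bigr => j _.
rewrite set_rowE eqxx mxE; congr (_ * (_ * \det _)).
by apply/matrixP => k l; rewrite !mxE eq_sym (negbTE (neq_lift _ _)) mxE.
Qed.

Lemma det_multilinear : multilinear (fun g : 'M[R]_p => \det g).
Proof.
move=> i a u v g; rewrite !det_set_row mulr_sumr -big_split; apply: eq_bigr.
by move=> j _; rewrite !mxE mulrDl mulrA.
Qed.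

Lemma sum_det_set_row (U g : 'M[R]_p) :
  \sum_i \det (set_row i (row i U) g) = \tr (U *m \adj g).
Proof.
apply: eq_bigr => i _; rewrite det_set_row mxE.
by apply: eq_bigr => j _; rewrite mxE.
Qed.

End Determinant.

Definition posdef (R : realType) (p : nat) (g : 'M[R]_p) :=
  g^T = g /\ forall v : 'rV[R]_p, v != 0 -> 0 < (v *m g *m v^T) 0 0.

Section PositiveDefinite.
Variable R : realType.

(** Completing the square in the first variable and induction on the Schur
    complement. *)
Lemma posdef_factor (p : nat) (g : 'M[R]_p) :
  posdef g -> exists B : 'M[R]_p, g = B^T *m B.
Proof.
elim: p g => [|p IH] g [gs gp].
  by exists 0; apply/matrixP => -[].
rewrite -[p.+1]/(1 + p)%N in g gs gp *.
set a := ulsubmx g 0 0; set b := ursubmx g; set D := drsubmx g.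
have Eg : g = block_mx a%:M b b^T D.
  rewrite -[LHS]submxK -/b -/D; congr block_mx; first exact: mx11_scalar.
  by rewrite /b trmx_ursub gs.
have Ds : D^T = D by rewrite /D trmx_drsub gs.
have quad (x : 'rV[R]_1) (v : 'rV[R]_p) : (row_mx x v *m g *m (row_mx x v)^T) 0 0 =
    x 0 0 ^+ 2 * a + 2 * x 0 0 * (v *m b^T) 0 0 + (v *m D *m v^T) 0 0.
  rewrite Eg mul_row_block tr_row_mx mul_row_col (mx11_scalar x) !mul_scalar_mx.
  rewrite tr_scalar_mx mul_mx_scalar !mulmxDl -scalemxAl.
  have -> : b *m v^T = (v *m b^T)^T by rewrite trmx_mul trmxK.
  rewrite !mxE /= !mulr1n; ring.
have a0 : 0 < a.
  have := gp (row_mx 1%:M 0); rewrite quad !mul0mx !mxE /= mulr0 !addr0 expr1n mul1r.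
  apply; apply/eqP => /(congr1 lsubmx); rewrite row_mxKl linear0 => /matrixP/(_ 0 0).
  by rewrite !mxE /= => /eqP; rewrite oner_eq0.
pose S := D - a^-1 *: (b^T *m b).
have [C SC] : exists C : 'M[R]_p, S = C^T *m C.
  apply: IH; split.
    by rewrite /S linearB linearZ /= trmx_mul trmxK Ds.
  move=> v v0; have := gp (row_mx (- a^-1 *: (v *m b^T)) v).
  rewrite quad.
  have -> : (v *m S *m v^T) 0 0 = (v *m D *m v^T) 0 0 - a^-1 * (v *m b^T) 0 0 ^+ 2.
    rewrite /S mulmxBr mulmxBl -scalemxAr -scalemxAl mulmxA -(mulmxA (v *m b^T)).
    have -> : b *m v^T = (v *m b^T)^T by rewrite trmx_mul trmxK.
    by rewrite [v *m b^T]mx11_scalar tr_scalar_mx -scalar_mxM !mxE eqxx !mulr1n.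
  (* the first coordinate that minimizes the form leaves the Schur complement *)
  have -> x : ((- a^-1 *: (v *m b^T)) 0 0) ^+ 2 * a
      + 2 * (- a^-1 *: (v *m b^T)) 0 0 * (v *m b^T) 0 0 + x =
      x - a^-1 * (v *m b^T) 0 0 ^+ 2.
    rewrite mxE; field; exact: lt0r_neq0.
  apply; apply: contraNneq v0 => /(congr1 rsubmx).
  by rewrite row_mxKr linear0 => ->.
exists (block_mx (Num.sqrt a)%:M ((Num.sqrt a)^-1 *: b) 0 C).
rewrite tr_block_mx mulmx_block Eg !tr_scalar_mx !trmx0 !mul0mx !mulmx0 !addr0.
have sa : Num.sqrt a != 0 by rewrite sqrtr_eq0 -ltNge.
have sa2 : Num.sqrt a * Num.sqrt a = a by rewrite -expr2 sqr_sqrtr // ltW.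
congr block_mx.
- by rewrite -scalar_mxM sa2.
- by rewrite mul_scalar_mx scalerA mulfV // scale1r.
- by rewrite linearZ /= mul_mx_scalar scalerA mulfV // scale1r.
- by rewrite -scalemxAr linearZ /= -scalemxAl scalerA -invfM sa2 -SC addrC subrK.
Qed.

Variable p : nat.
Implicit Type g : 'M[R]_p.

Lemma posdef_det g : posdef g -> 0 < \det g.
Proof.
move=> gp; have [B gB] := posdef_factor gp.
rewrite gB det_mulmx -[\det B]det_tr -expr2 lt0r sqr_ge0 andbT expf_neq0 //.
rewrite -unitfE -[_ \is a _]/(B^T \in unitmx) -row_free_unit -kermx_eq0.
apply/eqP/row_matrixP => i; rewrite row0; apply/eqP; apply: contraT => /(gp.2 _).
have /sub_kermxP vB : (row i (kermx B^T) <= kermx B^T)%MS by exact: row_sub.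
by rewrite gB mulmxA vB !mul0mx mxE ltxx.
Qed.

Lemma posdef_unit g : posdef g -> g \in unitmx.
Proof. by move=> /posdef_det d; rewrite unitmxE unitfE lt0r_neq0. Qed.

Lemma posdef_adj g : posdef g -> posdef (\adj g).
Proof.
move=> gp; have d := posdef_det gp; have u := posdef_unit gp.
have adjE : \adj g = \det g *: invmx g.
  by rewrite /invmx u scalerA mulfV ?scale1r // lt0r_neq0.
have iT : (invmx g)^T = invmx g by rewrite trmx_inv gp.1.
split=> [|v v0]; first by rewrite adjE linearZ /= iT.
have -> : v *m \adj g *m v^T = \det g *: ((v *m invmx g) *m g *m (v *m invmx g)^T).
  by rewrite adjE -scalemxAr -scalemxAl mulmxKV // trmx_mul iT mulmxA.
rewrite mxE mulr_gt0 //; apply: gp.2; apply: contraNneq v0 => E.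
by rewrite -[v](mulmxKV u) E mul0mx.
Qed.

Lemma posdef_congr q g (J : 'M[R]_(q, p)) :
  posdef g -> row_free J -> posdef (J *m g *m J^T).
Proof.
move=> gp /row_freeP[K JK]; split; first by rewrite !trmx_mul trmxK gp.1 mulmxA.
move=> v v0.
have -> : v *m (J *m g *m J^T) *m v^T = (v *m J) *m g *m (v *m J)^T.
  by rewrite trmx_mul !mulmxA.
apply: gp.2; apply: contraNneq v0 => E.
by rewrite -[v]mulmx1 -JK mulmxA E mul0mx.
Qed.

(** A positive semidefinite matrix is a sum of rank-one forms, so a second
    order operator with such coefficients is a sum of pure second derivatives. *)
Lemma posdef_trace_le0 g (K : 'M[R]_p) : posdef g ->
  (forall v : 'rV[R]_p, (v *m K *m v^T) 0 0 <= 0) -> \tr (g *m K) <= 0.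
Proof.
move=> gp Kn; have [B ->] := posdef_factor gp.
rewrite -mulmxA mxtrace_mulC; apply: sumr_le0 => i _.
rewrite -(_ : (row i B *m K *m (row i B)^T) 0 0 = (B *m K *m B^T) i i) ?Kn //.
by rewrite -row_mul !mxE; apply: eq_bigr => j _; rewrite !mxE.
Qed.

End PositiveDefinite.

(** * Directional derivatives *)

Section DirectionalDerivatives.
Variables (R : realType) (V : normedModType R).
Implicit Types (x v : V) (f g : V -> R).

Lemma is_derive_line (W : normedModType R) (f : V -> W) x v (t : R) df :
  is_derive (t *: v + x) v f df -> is_derive t 1 (fun r : R => f (r *: v + x)) df.
Proof.
move=> [fd fe].
have E : (fun h : R => h^-1 *: (((fun r : R => f (r *: v + x)) \o shift t) (h *: 1) - f (t *: v + x))) =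
    (fun h => h^-1 *: ((f \o shift (t *: v + x)) (h *: v) - f (t *: v + x))).
  by apply/funext => h /=; rewrite [h *: 1]mulr1 scalerDl addrA.
by split; rewrite /derivable /derive /= E.
Qed.

Lemma is_derive_sum_fun (I : Type) (r : seq I) (P : pred I) (h : I -> V -> R) (dh : I -> R) x v :
  (forall i, is_derive x v (h i) (dh i)) ->
  is_derive x v (fun y => \sum_(i <- r | P i) h i y) (\sum_(i <- r | P i) dh i).
Proof.
move=> H; elim: r => [|i r IH].
  rewrite big_nil; under eq_fun do rewrite big_nil; exact: is_derive_cst.
rewrite big_cons; under eq_fun do rewrite big_cons.
by case: (P i) => //; exact: is_deriveD.
Qed.

Lemma is_derive_mul f g x v df dg : is_derive x v f df -> is_derive x v g dg ->
  is_derive x v (fun y => f y * g y) (f x * dg + g x * df).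
Proof. move=> fd gd; exact: is_deriveM. Qed.

Lemma is_derive_scale (c : R) f x v df : is_derive x v f df ->
  is_derive x v (fun y => c * f y) (c * df).
Proof.
move=> fd; have := is_derive_mul (is_derive_cst c x v) fd.
by rewrite mulr0 addr0.
Qed.

Lemma is_derive_differentiable (W : normedModType R) (f : V -> W) x v :
  differentiable f x -> is_derive x v f ('D_v f x).
Proof. by move=> df; apply: derivableP; exact: diff_derivable. Qed.

Lemma derive_compE (W Z : normedModType R) (u : V -> W) (f : W -> Z) x v :
  differentiable u x -> differentiable f (u x) ->
  'D_v (f \o u) x = 'D_('D_v u x) f (u x).
Proof.
move=> du df; rewrite deriveE; last exact: differentiable_comp.
by rewrite diff_comp //= -(deriveE v du) -(deriveE _ df).
Qed.

Lemma is_derive_comp_fun (W Z : normedModType R) (u : V -> W) (f : W -> Z) x v :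
  differentiable u x -> differentiable f (u x) ->
  is_derive x v (fun y => f (u y)) ('D_('D_v u x) f (u x)).
Proof.
move=> du df; rewrite -derive_compE //; apply: derivableP; apply: diff_derivable.
exact: differentiable_comp.
Qed.

Lemma differentiable_sum_fun (I : Type) (r : seq I) (P : pred I) (h : I -> V -> R) x :
  (forall i, differentiable (h i) x) ->
  differentiable (fun y => \sum_(i <- r | P i) h i y) x.
Proof.
move=> H; elim: r => [|i r IH].
  under eq_fun do rewrite big_nil; exact: differentiable_cst.
under eq_fun do rewrite big_cons.
by case: (P i) => //; exact: differentiableD.
Qed.

Lemma differentiable_mul f g x : differentiable f x -> differentiable g x ->
  differentiable (fun y => f y * g y) x.
Proof. move=> fd gd; exact: differentiableM. Qed.

Lemma differentiable_scale (c : R) f x : differentiable f x ->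
  differentiable (fun y => c * f y) x.
Proof. by move=> df; apply: differentiable_mul => //; exact: differentiable_cst. Qed.

End DirectionalDerivatives.

Lemma derive_rV (R : realType) m (f : 'rV[R]_m -> R) x v : differentiable f x ->
  'D_v f x = \sum_k v 0 k * 'D_(delta_mx 0 k) f x.
Proof.
move=> df; rewrite deriveE // {1}(row_sum_delta v) linear_sum.
by apply: eq_bigr => k _; rewrite linearZ /= deriveE.
Qed.

Lemma derive_entry (R : realType) (V : normedModType R) m n (A : V -> 'M[R]_(m, n)) x v i j :
  differentiable A x -> 'D_v (fun y => A y i j) x = ('D_v A x) i j.
Proof. by move=> dA; rewrite derive_mx ?mxE //; exact: diff_derivable. Qed.

Lemma differentiable_entry (R : realType) (V : normedModType R) m n (A : V -> 'M[R]_(m, n)) x i j :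
  differentiable A x -> differentiable (fun y => A y i j) x.
Proof.
move=> dA; apply: (@differentiable_comp _ _ _ _ A (fun N : 'M[R]_(m, n) => N i j)) => //.
exact: differentiable_coord.
Qed.

Section OnceContinuouslyDifferentiable.
Variables (R : realType) (V : normedModType R) (U : set V).
Hypothesis oU : open U.
Implicit Types (x v : V) (f g : V -> R).

Lemma continuous_eq_on (W : normedModType R) (f g : V -> W) x :
  (forall y, U y -> f y = g y) -> U x ->
  {for x, continuous f} -> {for x, continuous g}.
Proof.
move=> fg Ux; rewrite /prop_for /continuous_at -(fg x Ux) => cf.
apply: cvg_trans cf; apply: near_eq_cvg.
by have := open_nbhs_nbhs (conj oU Ux); apply: filterS.
Qed.

Lemma Ck1_cst (c : R) : Ck 1 U (fun _ => c).
Proof.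
split=> [x Ux|v x Ux]; first exact: differentiable_cst.
apply: (@continuous_eq_on _ (cst 0)) => //; last exact: cst_continuous.
by move=> y _; rewrite derive_cst.
Qed.

Lemma Ck1D f g : Ck 1 U f -> Ck 1 U g -> Ck 1 U (fun x => f x + g x).
Proof.
move=> [fd fc] [gd gc]; split=> [x Ux|v x Ux].
  by apply: differentiableD; [exact: fd|exact: gd].
apply: (@continuous_eq_on _ (fun y => 'D_v f y + 'D_v g y)) => //.
  move=> y Uy; rewrite -deriveD //; apply: diff_derivable; [exact: fd|exact: gd].
by apply: cvgD; [exact: fc|exact: gc].
Qed.

Lemma Ck1M f g : Ck 1 U f -> Ck 1 U g -> Ck 1 U (fun x => f x * g x).
Proof.
move=> [fd fc] [gd gc]; split=> [x Ux|v x Ux].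
  by apply: differentiableM; [exact: fd|exact: gd].
apply: (@continuous_eq_on _ (fun y => f y * 'D_v g y + g y * 'D_v f y)) => //.
  move=> y Uy; rewrite -[LHS]/(f y *: _ + g y *: _) -deriveM //;
  apply: diff_derivable; [exact: fd|exact: gd].
apply: cvgD; apply: cvgM; [|exact: gc| |exact: fc].
  by apply: differentiable_continuous; exact: fd.
by apply: differentiable_continuous; exact: gd.
Qed.

Lemma Ck1_sum (I : Type) (r : seq I) (P : pred I) (h : I -> V -> R) :
  (forall i, Ck 1 U (h i)) -> Ck 1 U (fun x => \sum_(i <- r | P i) h i x).
Proof.
move=> H; elim: r => [|i r IH].
  under eq_fun do rewrite big_nil; exact: (Ck1_cst 0).
under eq_fun do rewrite big_cons; case: (P i); [exact: (Ck1D (H i) IH)|exact: IH].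
Qed.

Lemma Ck1_prod (I : Type) (r : seq I) (P : pred I) (h : I -> V -> R) :
  (forall i, Ck 1 U (h i)) -> Ck 1 U (fun x => \prod_(i <- r | P i) h i x).
Proof.
move=> H; elim: r => [|i r IH].
  under eq_fun do rewrite big_nil; exact: (Ck1_cst 1).
under eq_fun do rewrite big_cons; case: (P i); [exact: (Ck1M (H i) IH)|exact: IH].
Qed.

Lemma Ck1_entry m n (A : V -> 'M[R]_(m, n)) i j :
  Ck 1 U A -> Ck 1 U (fun x => A x i j).
Proof.
move=> [Ad Ac]; split=> [x Ux|v x Ux]; first by apply: differentiable_entry; exact: Ad.
apply: (@continuous_eq_on _ (fun y => ('D_v A y) i j)) => //.
  by move=> y Uy; rewrite derive_entry //; exact: Ad.
apply: (@continuous_comp _ _ _ ('D_v A) (fun N : 'M[R]_(m, n) => N i j)).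
  exact: Ac.
exact: coord_continuous.
Qed.

Lemma Ck1_comp m (u : V -> 'rV[R]_m) (U' : set 'rV[R]_m) (f : 'rV[R]_m -> R) :
  Ck 1 U u -> Ck 1 U' f -> (forall x, U x -> U' (u x)) -> Ck 1 U (fun x => f (u x)).
Proof.
move=> Cu [fd fc] UU'; have [ud uc] := Cu; split=> [x Ux|v x Ux].
  by apply: differentiable_comp; [exact: ud|exact/fd/UU'].
apply: (@continuous_eq_on _ (fun y => \sum_k ('D_v u y) 0 k * 'D_(delta_mx 0 k) f (u y))) => //.
  move=> y Uy; rewrite -derive_rV; last exact/fd/UU'.
  by rewrite -derive_compE //; [exact: ud|exact/fd/UU'].
have cu : {for x, continuous u} by apply: differentiable_continuous; exact: ud.
apply: (@cvg_big _ _ _ _ _ add_continuous) => k _.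
apply: cvgM.
  apply: (@continuous_comp _ _ _ ('D_v u) (fun N : 'rV[R]_m => N 0 k)).
    exact: uc.
  exact: coord_continuous.
apply: (@continuous_comp _ _ _ u ('D_(delta_mx 0 k) f)) => //.
by apply: fc; exact: UU'.
Qed.

Lemma Ck1_det n (A : V -> 'M[R]_n) : (forall i j, Ck 1 U (fun x => A x i j)) ->
  Ck 1 U (fun x => \det (A x)).
Proof.
move=> CA; apply: Ck1_sum => s; apply: Ck1M; first exact: Ck1_cst.
exact: Ck1_prod.
Qed.

Lemma Ck1_adj n (A : V -> 'M[R]_n) i j : (forall i j, Ck 1 U (fun x => A x i j)) ->
  Ck 1 U (fun x => \adj (A x) i j).
Proof.
move=> CA; under eq_fun do rewrite mxE; apply: Ck1M; first exact: Ck1_cst.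
by apply: Ck1_det => k l; under eq_fun do rewrite !mxE.
Qed.

Lemma Ck1_mul m n q (A : V -> 'M[R]_(m, n)) (B : V -> 'M[R]_(n, q)) i j :
  (forall i j, Ck 1 U (fun x => A x i j)) -> (forall i j, Ck 1 U (fun x => B x i j)) ->
  Ck 1 U (fun x => (A x *m B x) i j).
Proof.
move=> CA CB; under eq_fun do rewrite mxE; apply: Ck1_sum => k; exact: Ck1M.
Qed.

End OnceContinuouslyDifferentiable.

Section MultilinearDerivative.
Variables (R : realType) (V : normedModType R) (p n : nat).
Variables (x v : V) (om : V -> 'M[R]_(p, n) -> R) (dom : 'M[R]_(p, n) -> R).
Hypothesis om_multilinear : \forall y \near x, multilinear (om y).
Hypothesis om_derive : forall W, is_derive x v (om ^~ W) (dom W).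

Lemma derive_multilinear : multilinear dom.
Proof.
move=> i a u1 u2 W.
have -> : dom (set_row i (a *: u1 + u2) W) =
    'D_v (fun y => om y (set_row i (a *: u1 + u2) W)) x.
  by have [] := om_derive (set_row i (a *: u1 + u2) W).
rewrite (@near_eq_derive _ _ _ _ (fun y => om y (set_row i u1 W) * a + om y (set_row i u2 W))).
  have H1 := is_derive_mul (om_derive (set_row i u1 W)) (is_derive_cst a x v).
  have [_ ->] := is_deriveD H1 (om_derive (set_row i u2 W)).
  by rewrite mulr0 add0r.
by apply: filterS om_multilinear => y ym; rewrite ym mulrC.
Qed.

Variables (Wf : V -> 'M[R]_(p, n)) (dW : 'M[R]_(p, n)).
Hypothesis Wf_derive : forall i k, is_derive x v (fun y => Wf y i k) (dW i k).

(* Hybrids of Z and W, along which the induction on k lets one more row vary. *)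
Let mix k (W Z : 'M[R]_(p, n)) : 'M[R]_(p, n) :=
  \matrix_(i < p) (if (i < k)%N then row i W else row i Z).

Let mixS (k : 'I_p) W Z : mix k.+1 W Z = set_row k (row k W) (mix k W Z).
Proof.
apply/matrixP => i j; rewrite set_rowE !mxE ltnS leq_eqVlt -val_eqE.
by case: (eqVneq (val i) (val k)) => [/val_inj ->|] //=; rewrite mxE.
Qed.

Let mix_set_row (k : 'I_p) u W Z : mix k W (set_row k u Z) = set_row k u (mix k W Z).
Proof.
apply/matrixP => i j; rewrite set_rowE !mxE.
by case: (eqVneq i k) => [->|ik]; rewrite ?ltnn ?mxE ?eqxx //;
   case: ltnP => _; rewrite !mxE ?(negbTE ik) ?mxE.
Qed.

(** The product rule for a multilinear form that varies together with its
    arguments. The induction lets one more row vary at each step, expanding it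
    in the canonical basis: only the derivatives of the form on constant
    arguments are ever needed. *)
Lemma is_derive_multilinear :
  is_derive x v (fun y => om y (Wf y))
    (dom (Wf x) + \sum_i om x (set_row i (row i dW) (Wf x))).
Proof.
have mx := nbhs_singleton om_multilinear.
suff main k Z : (k <= p)%N -> is_derive x v (fun y => om y (mix k (Wf y) Z))
    (dom (mix k (Wf x) Z) +
     \sum_(i < p | (i < k)%N) om x (set_row i (row i dW) (mix k (Wf x) Z))).
  have mixp W : mix p W 0 = W by apply/matrixP => i j; rewrite !mxE ltn_ord mxE.
  have := main p 0 (leqnn p).
  under eq_fun do rewrite mixp.
  by rewrite mixp (eq_bigl xpredT) // => i; rewrite ltn_ord.
elim: k Z => [|k IH] Z kp.
  have mix0 W : mix 0 W Z = Z by apply/matrixP => i j; rewrite !mxE.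
  under eq_fun do rewrite mix0.
  by rewrite mix0 big_pred0 ?addr0.
pose ko := Ordinal kp; have IHl l := IH (set_row ko (delta_mx 0 l) Z) (ltnW kp).
have := is_derive_sum_fun (index_enum 'I_n) xpredT (fun l => is_derive_mul (Wf_derive ko l) (IHl l)).
set d1 := \sum_l _ => H.
have -> : dom (mix k.+1 (Wf x) Z) +
  \sum_(i < p | (i < k.+1)%N) om x (set_row i (row i dW) (mix k.+1 (Wf x) Z)) = d1.
  rewrite /d1 big_split /= [LHS]addrC.
  have mS W : mix k.+1 W Z = set_row ko (row ko W) (mix k W Z) by exact: (mixS ko).
  have ms u W : mix k W (set_row ko u Z) = set_row ko u (mix k W Z).
    exact: (mix_set_row ko).
  rewrite [X in X + _](bigD1 ko) //= mS set_rowK -[LHS]addrA [RHS]addrC; congr (_ + _).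
    by rewrite (multilinear_row mx); apply: eq_bigr => l _; rewrite ms mxE mulrC.
  under [RHS]eq_bigr do rewrite mulrDr.
  rewrite big_split /= addrC; congr (_ + _).
    rewrite (multilinear_row derive_multilinear).
    by apply: eq_bigr => l _; rewrite ms mxE.
  under [RHS]eq_bigr do rewrite mulr_sumr.
  rewrite [RHS]exchange_big /=; apply: eq_big => [i|i /andP[ik ik']].
    by rewrite ltnS leq_eqVlt -val_eqE /=; case: ltngtP.
  rewrite set_rowC // (multilinear_row mx); apply: eq_bigr => l _.
  by rewrite mxE ms set_rowC // eq_sym.
apply: near_eq_is_derive H.
apply: filterS om_multilinear => y ym.
have -> : mix k.+1 (Wf y) Z = set_row ko (row ko (Wf y)) (mix k (Wf y) Z) by exact: (mixS ko).
rewrite multilinear_row //; apply: eq_bigr => l _; rewrite mxE; congr (_ * om y _).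
exact: (mix_set_row ko).
Qed.

End MultilinearDerivative.

(** Jacobi's formula: the product rule for the determinant as a multilinear form
    of the rows, expanded along the row that is differentiated. *)
Lemma is_derive_det (R : realType) (V : normedModType R) p (x v : V)
    (A : V -> 'M[R]_p) (dA : 'M[R]_p) :
  (forall i j, is_derive x v (fun y => A y i j) (dA i j)) ->
  is_derive x v (fun y => \det (A y)) (\tr (dA *m \adj (A x))).
Proof.
move=> H; have := @is_derive_multilinear R V p p x v (fun _ W => \det W) (fun _ => 0) _ _ A dA H.
rewrite add0r sum_det_set_row; apply.
by apply: nearW => _; exact: det_multilinear.
Qed.

Section SecondDerivatives.
Variables (R : realType) (V : normedModType R).
Implicit Types (x v w : V) (f : V -> R).

Lemma mean_value_line f x v (t : R) : 0 < t ->
  (forall r, 0 <= r <= t -> differentiable f (r *: v + x)) ->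
  exists2 r, 0 < r < t & f (t *: v + x) - f x = t * 'D_v f (r *: v + x).
Proof.
move=> t0 fd.
have fl r : 0 <= r <= t -> is_derive r 1 (fun r : R => f (r *: v + x)) ('D_v f (r *: v + x)).
  by move=> rt; apply/is_derive_line/is_derive_differentiable/fd.
have [r|r|r rt E] := @MVT R (fun r : R => f (r *: v + x)) (fun r => 'D_v f (r *: v + x)) 0 t t0.
- by rewrite in_itv /= => /andP[r0 rt]; apply: fl; rewrite !ltW.
- apply: derivable_within_continuous => s; rewrite in_itv /= => st.
  by have [] := fl s st.
- by exists r; [move: rt; rewrite in_itv|move: E; rewrite scale0r add0r subr0 mulrC].
Qed.

(** The mean value theorem applied first along [v] to the increment of [f] along
    [w], then along [w] to the derivative. *)
Lemma mean_value_square f fv x v w (t : R) : 0 < t ->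
  (forall r s, 0 <= r <= t -> 0 <= s <= t ->
     let y := r *: v + (s *: w + x) in
     [/\ differentiable f y, 'D_v f y = fv y & differentiable fv y]) ->
  exists r s, [/\ 0 <= r <= t, 0 <= s <= t &
    (f (t *: v + (t *: w + x)) - f (t *: v + x)) - (f (t *: w + x) - f x) =
    t * (t * 'D_w fv (r *: v + (s *: w + x)))].
Proof.
move=> t0 fd; have tt : 0 <= t <= t by rewrite lexx ltW.
have t00 : (0 : R) <= 0 <= t by rewrite lexx ltW.
pose g y := f (t *: w + y) - f y.
have gd r : 0 <= r <= t -> is_derive (r *: v + x) v g
    (fv (r *: v + (t *: w + x)) - fv (r *: v + x)).
  move=> rt; have [f1 <- _] := fd r t rt tt; have [] := fd r 0 rt t00.
  rewrite scale0r add0r => f0 <- _; rewrite addrCA; apply: is_deriveB; last first.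
    exact: is_derive_differentiable.
  have shd : differentiable (fun y : V => t *: w + y) (r *: v + x).
    by apply: differentiableD => //; exact: differentiable_cst.
  have shE : 'D_v (fun y : V => t *: w + y) (r *: v + x) = v.
    by rewrite deriveD ?derive_cst ?derive_id ?add0r.
  have fd' : differentiable f (t *: w + (r *: v + x)).
    by move: f1; rewrite addrCA.
  by have := is_derive_comp_fun v shd fd'; rewrite shE.
have gl r : 0 <= r <= t -> is_derive r 1 (fun r : R => g (r *: v + x))
    (fv (r *: v + (t *: w + x)) - fv (r *: v + x)).
  by move=> rt; apply/is_derive_line/gd.
have [r|r|r rt] := @MVT R (fun r : R => g (r *: v + x)) 
   (fun r => fv (r *: v + (t *: w + x)) - fv (r *: v + x)) 0 t t0.
- by rewrite in_itv /= => /andP[r0 rt]; apply: gl; rewrite !ltW.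
- apply: derivable_within_continuous => s; rewrite in_itv /= => st.
  by have [] := gl s st.
have {}rt : 0 <= r <= t by move: rt; rewrite in_itv /= => /andP[? ?]; rewrite !ltW.
rewrite scale0r add0r subr0 /g => E.
have [s|s st Es] := @mean_value_line fv (r *: v + x) w t t0.
  by move=> st; rewrite addrCA; have [] := fd r s rt st.
exists r, s; split=> //; first by case/andP: st => *; rewrite !ltW.
by rewrite addrCA E mulrC addrCA Es addrCA.
Qed.

(** Both iterated derivatives are values, at nearby points, of the same second
    difference quotient. *)
Lemma derive_symmetric f fv fw (U : set V) x v w : open U -> U x ->
  (forall y, U y -> differentiable f y) ->
  (forall y, U y -> 'D_v f y = fv y) -> (forall y, U y -> 'D_w f y = fw y) ->
  (forall y, U y -> differentiable fv y) -> (forall y, U y -> differentiable fw y) ->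
  {for x, continuous ('D_w fv)} -> {for x, continuous ('D_v fw)} ->
  'D_w fv x = 'D_v fw x.
Proof.
move=> oU Ux fd fvE fwE dv dw cv cw; have nU := open_nbhs_nbhs (conj oU Ux).
apply/eqP; rewrite -subr_eq0 -normr_le0; apply/ler_addgt0Pl => e e0; rewrite addr0.
have e20 : 0 < e / 2 by rewrite divr_gt0.
have /cvgrPdist_lt/(_ _ e20) n1 := cv.
have /cvgrPdist_lt/(_ _ e20) n2 := cw.
have [d /= d0 dP] := (@nbhs_ballP R V x _).1 (filterI nU (filterI n1 n2)).
(* small enough for the parallelogram with sides t v and t w to stay in the ball *)
pose N := `|v| + `|w| + 1.
have N0 : 0 < N by rewrite /N ltr_pwDr // addr_ge0.
pose t := d / 2 / N.
have t0 : 0 < t by rewrite !divr_gt0.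
have near_x r s : 0 <= r <= t -> 0 <= s <= t -> ball x d (r *: v + (s *: w + x)).
  move=> /andP[r0 rt] /andP[s0 st]; rewrite -ball_normE /= addrA opprD addrA addrAC subrr add0r normrN.
  apply: le_lt_trans (ler_normD _ _) _; rewrite !normrZ !ger0_norm //.
  apply: (@le_lt_trans _ _ (t * (`|v| + `|w|))).
    by rewrite mulrDr lerD // ler_wpM2r.
  apply: (@le_lt_trans _ _ (t * N)); first by rewrite (ler_wpM2l (ltW t0)) // /N lerDl.
  by rewrite /t divfK ?lt0r_neq0 // ltr_pdivrMr // ltr_pMr // ltr1n.
have [r|r [s [rt st E1]]] := @mean_value_square f fv x v w t t0.
  move=> s rt st; have [Uy _] := dP _ (near_x r s rt st).
  by split; [exact: fd|exact: fvE|exact: dv].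
have [r'|r' [s' [rt' st' E2]]] := @mean_value_square f fw x w v t t0.
  move=> s' rt' st'; have := near_x s' r' st' rt'; rewrite addrCA => /dP[Uy _].
  by split; [exact: fd|exact: fwE|exact: dw].
have E : 'D_w fv (r *: v + (s *: w + x)) = 'D_v fw (r' *: w + (s' *: v + x)).
  have tn : t != 0 by rewrite lt0r_neq0.
  apply: (mulfI tn); apply: (mulfI tn); rewrite -E1 -E2 [t *: w + (_ + _)]addrCA; ring.
have [_ [/= /ltW A _]] := dP _ (near_x r s rt st).
have := near_x s' r' st' rt'; rewrite addrCA => /dP[_ [_ /= /ltW B]].
rewrite -E distrC in B.
rewrite -(subrKA ('D_w fv (r *: v + (s *: w + x)))) (splitr e).
exact: le_trans (ler_normD _ _) (lerD A B).
Qed.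

(** Were the second derivative positive, [f] would increase strictly along [v]
    after [x], its first derivative vanishing there. *)
Lemma second_derivative_max f df (U : set V) x v : open U -> U x ->
  (forall y, U y -> is_derive y v f (df y)) -> derivable df x v ->
  (forall y, U y -> f y <= f x) -> df x = 0 /\ 'D_v df x <= 0.
Proof.
move=> oU Ux fd dfd fmax.
have /nbhs_ballP[d /= d0 dP] : nbhs (0 : R) (fun r : R => U (r *: v + x)).
  have c : {for 0, continuous (fun r : R => r *: v + x)}.
    apply: cvgD; last exact: cvg_cst.
    by apply: cvgZ; [exact: cvg_id|exact: cvg_cst].
  by apply: c; rewrite scale0r add0r; exact: open_nbhs_nbhs.
have Ul (r : R) : r \in `](- d), d[%R -> U (r *: v + x).
  by rewrite in_itv /= -ltr_norml => rd; apply: dP; rewrite /ball /= sub0r normrN.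
have fl (r : R) : r \in `](- d), d[%R -> is_derive r 1 (fun r : R => f (r *: v + x)) (df (r *: v + x)).
  by move=> rd; apply/is_derive_line/fd/Ul.
have zd : (0 : R) \in `](- d), d[%R by rewrite in_itv /= oppr_lt0 d0.
have df0 : df x = 0.
  have [|r rd||_] := @derive1_at_max R (fun r : R => f (r *: v + x)) (- d) d 0 _ _ zd.
  - by rewrite ltW // (lt_trans _ d0) ?oppr_lt0.
  - by have [] := fl r rd.
  - by move=> r rd; rewrite scale0r add0r; apply: fmax; exact: Ul.
  - by have [_ ->] := fl 0 zd; rewrite scale0r add0r.
split=> //; rewrite leNgt; apply/negP => pos.
have := dfd; rewrite /derivable => /(@cvgrPdist_lt _ _ _ _ _)/(_ _ pos).
rewrite near_withinE => -[e /= e0 eP].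
pose t := Num.min e d / 2.
have m0 : 0 < Num.min e d by rewrite lt_min e0 d0.
have tm : t < Num.min e d by rewrite ltr_pdivrMr // ltr_pMr // ltr1n.
have t0 : 0 < t by rewrite divr_gt0.
have /andP[te td] : (t < e) && (t < d) by move: tm; rewrite lt_min.
have dfpos r : 0 < r < t -> 0 < df (r *: v + x).
  move=> /andP[r0 rt]; have := eP r; rewrite /ball /= sub0r normrN gtr0_norm // (lt_trans rt te).
  move=> /(_ isT (lt0r_neq0 r0)) /ltr_normlP[_].
  rewrite [X in X - _](_ : _ = 'D_v df x) // df0 subr0.
  rewrite ltrBlDr ltrDl -[r^-1 *: _]/(r^-1 * _).
  by rewrite pmulr_rgt0 // invr_gt0.
have sub r : 0 <= r <= t -> r \in `](- d), d[%R.
  move=> /andP[r0 rt]; rewrite in_itv /= (le_lt_trans rt td) andbT.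
  by rewrite (lt_le_trans _ r0) // oppr_lt0.
have fd1 r : r \in `]0, t[%R -> is_derive r 1 (fun r : R => f (r *: v + x)) (df (r *: v + x)).
  by rewrite in_itv /= => /andP[r0 rt]; apply/fl/sub; rewrite !ltW.
have fc1 : {within `[0, t], continuous (fun r : R => f (r *: v + x))}.
  apply: derivable_within_continuous => s; rewrite in_itv /= => st.
  by have [] := fl s (sub _ st).
have [r rt] := MVT t0 fd1 fc1.
rewrite in_itv /= in rt; rewrite scale0r add0r subr0 => E.
have : 0 < f (t *: v + x) - f x by rewrite E mulr_gt0 // dfpos.
by rewrite subr_gt0 ltNge fmax //; apply/Ul/sub; rewrite lexx ltW.
Qed.

End SecondDerivatives.

(** * The strong maximum principle *)

Section MaximumPrinciple.
Variables (R : realType) (p : nat).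
Implicit Types (s y z : 'rV[R]_p) (U : set 'rV[R]_p).

Definition elliptic (a : 'M[R]_p) (b : 'rV[R]_p) (g : 'I_p -> R) (H : 'I_p -> 'I_p -> R) : R :=
  \sum_i \sum_j a i j * H i j + \sum_j b 0 j * g j.

(** At a maximum the gradient vanishes and the Hessian is negative semidefinite;
    its entries are used through [d], which has to be the gradient of [h] on a
    whole neighbourhood. *)
Lemma elliptic_max U s (h : 'rV[R]_p -> R) (d : 'I_p -> 'rV[R]_p -> R) a b :
  open U -> U s -> posdef a ->
  (forall y, U y -> differentiable h y) ->
  (forall y j, U y -> 'D_(delta_mx 0 j) h y = d j y) ->
  (forall j, differentiable (d j) s) ->
  (forall y, U y -> h y <= h s) ->
  elliptic a b (d^~ s) (fun i j => 'D_(delta_mx 0 i) (d j) s) <= 0.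
Proof.
move=> oU Us ap hd hD dd hmax.
have line (v : 'rV[R]_p) : (\sum_j v 0 j * d j s = 0) /\
    'D_v (fun y => \sum_j v 0 j * d j y) s <= 0.
  apply: (second_derivative_max oU Us _ _ hmax).
    move=> y Uy; rewrite -(_ : 'D_v h y = \sum_j v 0 j * d j y).
      exact/is_derive_differentiable/hd.
    by rewrite (derive_rV v (hd y Uy)); apply: eq_bigr => j _; rewrite hD.
  apply: diff_derivable; apply: differentiable_sum_fun => j.
  by apply: differentiable_mul => //; exact: differentiable_cst.
have d0 j : d j s = 0.
  have [+ _] := line (delta_mx 0 j); rewrite (bigD1 j) //= mxE !eqxx mul1r big1 ?addr0 //.
  by move=> k kj; rewrite mxE (negbTE kj) andbF mul0r.
rewrite /elliptic [X in _ + X]big1 ?addr0; last by move=> j _; rewrite d0 mulr0.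
pose K : 'M[R]_p := \matrix_(j, i) 'D_(delta_mx 0 i) (d j) s.
have -> : \sum_i \sum_j a i j * 'D_(delta_mx 0 i) (d j) s = \tr (a *m K).
  by apply: eq_bigr => i _; rewrite mxE; apply: eq_bigr => j _; rewrite mxE.
apply: posdef_trace_le0 => // v; have [_] := line v.
rewrite (_ : 'D_v _ s = (v *m K *m v^T) 0 0) //.
have dv j : is_derive s v (fun y => v 0 j * d j y) (v 0 j * 'D_v (d j) s).
  have := is_derive_mul (is_derive_cst (v 0 j) s v) (is_derive_differentiable v (dd j)).
  by rewrite mulr0 addr0.
have [_ ->] := is_derive_sum_fun (index_enum 'I_p) xpredT dv.
under eq_bigr do rewrite derive_rV // mulr_sumr.
rewrite mxE exchange_big /=; apply: eq_bigr => i _.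
rewrite !mxE mulr_suml; apply: eq_bigr => j _; rewrite mxE; ring.
Qed.

Definition sqdist y s : R := \sum_k (s 0 k - y 0 k) ^+ 2.

Lemma sqdist_ge0 y s : 0 <= sqdist y s.
Proof. by apply: sumr_ge0 => k _; exact: sqr_ge0. Qed.

Lemma sqdist_eq0 y s : sqdist y s = 0 -> s = y.
Proof.
move=> /eqP; rewrite psumr_eq0 => [|k _]; last exact: sqr_ge0.
move=> /allP H; apply/rowP => k; apply/eqP; rewrite -subr_eq0 -sqrf_eq0.
by have := H k (mem_index_enum k).
Qed.

Lemma sqdist_gt0 y s : s != y -> 0 < sqdist y s.
Proof.
move=> sy; rewrite lt0r sqdist_ge0 andbT.
by apply: contraNneq sy => /sqdist_eq0 ->.
Qed.

Lemma sqdistxx y : sqdist y y = 0.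
Proof. by rewrite /sqdist big1 // => k _; rewrite subrr expr0n. Qed.

Lemma sqdistC y s : sqdist y s = sqdist s y.
Proof. by apply: eq_bigr => k _; rewrite -sqrrN opprB. Qed.

Lemma norm_sqdist y s (e : R) : 0 < e -> sqdist y s < e ^+ 2 -> `|s - y| < e.
Proof.
move=> e0 lt; rewrite [ltLHS]/Num.Def.normr /= mx_normrE.
apply/bigmax_ltP; split=> // -[i k] _ /=; rewrite ord1 mxE mxE.
rewrite -(ltr_pXn2r (_ : 0 < 2)%N) // ?nnegrE ?ltW // real_normK ?num_real //.
apply: le_lt_trans lt; rewrite /sqdist (bigD1 k) //= lerDl.
by apply: sumr_ge0 => l _; exact: sqr_ge0.
Qed.

Lemma is_derive_coord k s v : is_derive s v (fun x : 'rV[R]_p => x 0 k) (v 0 k).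
Proof.
have di : differentiable (id : 'rV[R]_p -> 'rV[R]_p) s by [].
have := is_derive_differentiable v (differentiable_entry 0 k di).
by rewrite (derive_entry v 0 k di) derive_id.
Qed.

Lemma differentiable_sqdist y s : differentiable (sqdist y) s.
Proof.
apply: differentiable_sum_fun => k.
have dk : differentiable (fun x : 'rV[R]_p => x 0 k - y 0 k) s.
  by apply: differentiableB; [exact: differentiable_coord|exact: differentiable_cst].
exact: differentiable_mul.
Qed.

Lemma continuous_sqdist y s : {for s, continuous (sqdist y)}.
Proof. exact/differentiable_continuous/differentiable_sqdist. Qed.

Lemma derive_sqdist y s j : 'D_(delta_mx 0 j) (sqdist y) s = 2 * (s 0 j - y 0 j).
Proof.
have dk k : is_derive s (delta_mx 0 j) (fun x : 'rV[R]_p => (x 0 k - y 0 k) ^+ 2)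
   (2 * (s 0 k - y 0 k) * (j == k)%:R).
  have d1 : is_derive s (delta_mx 0 j) (fun x : 'rV[R]_p => x 0 k - y 0 k) (j == k)%:R.
    have := is_deriveB (is_derive_coord k s (delta_mx 0 j)) (is_derive_cst (y 0 k) s (delta_mx 0 j)).
    by rewrite subr0 mxE eqxx eq_sym.
  by apply: is_derive_eq (is_derive_mul d1 d1) _; ring.
have [_ ->] := is_derive_sum_fun (index_enum 'I_p) xpredT dk.
rewrite (bigD1 j) //= eqxx mulr1 big1 ?addr0 // => k kj.
by rewrite eq_sym (negbTE kj) mulr0.
Qed.

Lemma compact_le (f : 'rV[R]_p -> R) y (c e : R) : (forall s, {for s, continuous f}) ->
  (forall s, f s <= c -> `|s - y| <= e) -> compact [set s | f s <= c].
Proof.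
move=> fc fb; apply: bounded_closed_compact; last first.
  apply: (@closed_comp _ _ f [set x | x <= c]); last exact: closed_le.
  by move=> s _; exact: fc.
exists (e + `|y|); split; first exact: num_real.
move=> M ltM s /= /fb se; apply: le_trans (ltW ltM).
by rewrite -[s](subrK y) (le_trans (ler_normD _ _)) // lerD2r.
Qed.

End MaximumPrinciple.

Lemma continuous_cst_at (R : realType) (T : topologicalType) (c : R) (x : T) :
  {for x, continuous (fun _ => c)}.
Proof. by move=> A; exact: cst_continuous. Qed.

Lemma continuous_sum_at (R : realType) (T : topologicalType) (I : Type) (r : seq I)
    (f : I -> T -> R) (x : T) : (forall i, {for x, continuous (f i)}) ->
  {for x, continuous (fun y => \sum_(i <- r) f i y)}.
Proof. move=> fc; apply: (@cvg_big _ _ _ _ _ add_continuous) => i _; exact: fc. Qed.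

Lemma continuous_mul_at (R : realType) (T : topologicalType) (f g : T -> R) (x : T) :
  {for x, continuous f} -> {for x, continuous g} ->
  {for x, continuous (fun y => f y * g y)}.
Proof. move=> fc gc; exact: cvgM fc gc. Qed.

Lemma continuous_add_at (R : realType) (T : topologicalType) (f g : T -> R) (x : T) :
  {for x, continuous f} -> {for x, continuous g} ->
  {for x, continuous (fun y => f y + g y)}.
Proof. move=> fc gc; exact: cvgD fc gc. Qed.

Section Barrier.
Variables (R : realType) (p : nat) (y z : 'rV[R]_p).
Implicit Types (s : 'rV[R]_p) (K : R).

(** Positive exactly inside the ball having the segment [y, z] as a diameter. *)
Definition ball_height s : R := sqdist y z - sqdist y s - sqdist z s.

Definition ball_height_grad (j : 'I_p) s : R :=
  - (2 * (s 0 j - y 0 j)) - 2 * (s 0 j - z 0 j).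

Definition barrier K s : R := ball_height s * (1 + K / 2 * ball_height s).

Definition barrier_grad K (j : 'I_p) s : R :=
  (1 + K * ball_height s) * ball_height_grad j s.

Definition barrier_hess K (i j : 'I_p) s : R :=
  K * ball_height_grad i s * ball_height_grad j s
  - 4 * (1 + K * ball_height s) * (i == j)%:R.

Lemma differentiable_ball_height s : differentiable ball_height s.
Proof.
apply: differentiableB; last exact: differentiable_sqdist.
apply: differentiableB; first exact: differentiable_cst.
exact: differentiable_sqdist.
Qed.

Lemma is_derive_ball_height j s :
  is_derive s (delta_mx 0 j) ball_height (ball_height_grad j s).
Proof.
have D x := is_derive_differentiable (delta_mx 0 j) (differentiable_sqdist x s).
have := is_deriveB (is_deriveB (is_derive_cst (sqdist y z) s (delta_mx 0 j)) (D y)) (D z).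
by rewrite !derive_sqdist sub0r.
Qed.

Lemma differentiable_ball_height_grad j s : differentiable (ball_height_grad j) s.
Proof.
have dc (x : 'rV[R]_p) : differentiable (fun s : 'rV[R]_p => 2 * (s 0 j - x 0 j)) s.
  apply: differentiable_mul; first exact: differentiable_cst.
  by apply: differentiableB; [exact: differentiable_coord|exact: differentiable_cst].
by apply: differentiableB; first apply: differentiableN; exact: dc.
Qed.

Lemma is_derive_ball_height_grad i j s :
  is_derive s (delta_mx 0 i) (ball_height_grad j) (- 4 * (i == j)%:R).
Proof.
set e := delta_mx 0 i.
have dc (x : 'rV[R]_p) : is_derive s e (fun s : 'rV[R]_p => 2 * (s 0 j - x 0 j)) (2 * (i == j)%:R).
  have d0 : is_derive s e (fun s : 'rV[R]_p => s 0 j - x 0 j) (i == j)%:R.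
    have := is_deriveB (is_derive_coord j s e) (is_derive_cst (x 0 j) s e).
    by rewrite subr0 mxE eqxx eq_sym.
  by apply: is_derive_eq (is_derive_scale 2 d0) _; ring.
have D := is_deriveB (is_deriveN (dc y)) (dc z).
by apply: (@is_derive_eq _ _ _ (ball_height_grad j) s e _ _ D); ring.
Qed.

Lemma differentiable_barrier K s : differentiable (barrier K) s.
Proof.
have dh := differentiable_ball_height s.
apply: differentiable_mul => //; apply: differentiableD; first exact: differentiable_cst.
by exact: differentiable_scale.
Qed.

Lemma derive_barrier K j s : 'D_(delta_mx 0 j) (barrier K) s = barrier_grad K j s.
Proof.
set e := delta_mx 0 j; have dh := is_derive_ball_height j s.
have d1 : is_derive s e (fun s => 1 + K / 2 * ball_height s) (K / 2 * ball_height_grad j s).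
  have := is_deriveD (is_derive_cst (1 : R) s e) (is_derive_scale (K / 2) dh).
  by rewrite add0r.
by have [_ ->] := is_derive_mul dh d1; rewrite /barrier_grad; field.
Qed.

Lemma is_derive_barrier_grad K i j s :
  is_derive s (delta_mx 0 i) (barrier_grad K j) (barrier_hess K i j s).
Proof.
set e := delta_mx 0 i; have dh := is_derive_ball_height i s.
have d1 : is_derive s e (fun s => 1 + K * ball_height s) (K * ball_height_grad i s).
  have := is_deriveD (is_derive_cst (1 : R) s e) (is_derive_scale K dh).
  by rewrite add0r.
apply: is_derive_eq (is_derive_mul d1 (is_derive_ball_height_grad i j s)) _.
rewrite /barrier_hess; ring.
Qed.

Lemma differentiable_barrier_grad K j s : differentiable (barrier_grad K j) s.
Proof.
have dh := differentiable_ball_height s.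
apply: differentiable_mul; last exact: differentiable_ball_height_grad.
apply: differentiableD; first exact: differentiable_cst.
by exact: differentiable_scale.
Qed.

(** The touching point [z] is on the sphere, where the gradient of the height is
    not zero: a large [K] makes the rank-one part of the Hessian dominate. *)
Lemma barrier_elliptic (a : 'rV[R]_p -> 'M[R]_p) (b : 'rV[R]_p -> 'rV[R]_p) :
  z != y -> posdef (a z) ->
  (forall i j, {for z, continuous (fun s => a s i j)}) ->
  (forall j, {for z, continuous (fun s => b s 0 j)}) ->
  exists2 K, 0 < K & \forall s \near z,
    0 < elliptic (a s) (b s) (barrier_grad K ^~ s) (fun i j => barrier_hess K i j s).
Proof.
move=> zy az ca cb.
have hz : ball_height z = 0 by rewrite /ball_height sqdistxx subr0 subrr.
(* at z the operator takes the value K Q + C on the barrier *)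
pose Q := \sum_i \sum_j a z i j * (ball_height_grad i z * ball_height_grad j z).
pose C := \sum_i \sum_j a z i j * (- 4 * (i == j)%:R) + \sum_j b z 0 j * ball_height_grad j z.
have Q0 : 0 < Q.
  have := az.2 (z - y); rewrite subr_eq0 => /(_ zy).
  have -> : Q = 4 * ((z - y) *m a z *m (z - y)^T) 0 0.
    rewrite mxE mulr_sumr /Q exchange_big; apply: eq_bigr => j _.
    rewrite mxE mulr_suml mulr_sumr; apply: eq_bigr => i _.
    rewrite /ball_height_grad !mxE; ring.
  by move=> q0; rewrite mulr_gt0.
pose K := (`|C| + 1) / Q.
have K0 : 0 < K by rewrite divr_gt0 // ltr_pwDr.
exists K => //.
pose E s := elliptic (a s) (b s) (barrier_grad K ^~ s) (fun i j => barrier_hess K i j s).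
have Ez : 0 < E z.
  have -> : E z = K * Q + C.
    rewrite /E /elliptic /C addrA; congr (_ + _); last first.
      by apply: eq_bigr => j _; rewrite /barrier_grad hz mulr0 addr0 mul1r.
    rewrite /Q mulr_sumr -big_split /=; apply: eq_bigr => i _.
    rewrite mulr_sumr -big_split /=; apply: eq_bigr => j _.
    rewrite /barrier_hess hz; ring.
  rewrite /K divfK ?lt0r_neq0 //; have := ler_norm (- C); rewrite normrN; lra.
have ch : {for z, continuous ball_height}.
  exact/differentiable_continuous/differentiable_ball_height.
have cg j : {for z, continuous (ball_height_grad j)}.
  exact/differentiable_continuous/differentiable_ball_height_grad.
have cc (c : R) := @continuous_cst_at R _ c z.
have c1 : {for z, continuous (fun s => 1 + K * ball_height s)}.
  exact: (continuous_add_at (cc 1) (continuous_mul_at (cc K) ch)).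
have cE : {for z, continuous E}.
  apply: continuous_add_at; apply: continuous_sum_at => i; last first.
    exact: (continuous_mul_at (cb i) (continuous_mul_at c1 (cg i))).
  apply: continuous_sum_at => j; apply: (continuous_mul_at (ca i j)).
  apply: continuous_add_at.
    exact: (continuous_mul_at (continuous_mul_at (cc K) (cg i)) (cg j)).
  have c4 := continuous_mul_at (continuous_mul_at (cc 4) c1) (cc (i == j)%:R).
  exact: (cvgN c4).
exact: (cvgr_gt _ cE _ Ez).
Qed.

End Barrier.

Section StrongMaximumPrinciple.
Variables (R : realType) (p : nat) (U : set 'rV[R]_p).
Variables (a : 'rV[R]_p -> 'M[R]_p) (b : 'rV[R]_p -> 'rV[R]_p).
Variables (h : 'rV[R]_p -> R) (d : 'I_p -> 'rV[R]_p -> R).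
Implicit Types (s y z : 'rV[R]_p).
Hypothesis oU : open U.
Hypothesis apos : forall s, U s -> posdef (a s).
Hypothesis ca : forall s i j, U s -> {for s, continuous (fun s => a s i j)}.
Hypothesis cb : forall s j, U s -> {for s, continuous (fun s => b s 0 j)}.
Hypothesis hd : forall s, U s -> differentiable h s.
Hypothesis hD : forall s j, U s -> 'D_(delta_mx 0 j) h s = d j s.
Hypothesis dd : forall s j, U s -> differentiable (d j) s.
Hypothesis subsolution : forall s, U s ->
  0 <= elliptic (a s) (b s) (d^~ s) (fun i j => 'D_(delta_mx 0 i) (d j) s).

(** Hopf's argument: near [z] the barrier is a strict subsolution, positive
    only where [h] stays below its maximum, so [h] plus a small multiple of it
    would have an interior maximum. *)
Lemma no_touching_ball y z (m : R) : U z -> z != y -> h z = m ->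
  (forall s, U s -> h s <= m) ->
  (forall s, sqdist y s < sqdist y z -> h s < m) -> False.
Proof.
move=> Uz zy hz hm hlt.
have [K K0 nE] := barrier_elliptic zy (apos Uz) (fun i j => @ca z i j Uz) (fun j => @cb z j Uz).
have bhz : ball_height y z z = 0 by rewrite /ball_height sqdistxx subr0 subrr.
have n1 : \forall s \near z, 0 < 1 + K / 2 * ball_height y z s.
  have c : {for z, continuous (fun s => 1 + K / 2 * ball_height y z s)}.
    apply: continuous_add_at; first exact: continuous_cst_at.
    apply: continuous_mul_at; first exact: continuous_cst_at.
    exact/differentiable_continuous/differentiable_ball_height.
  by apply: (cvgr_gt _ c); rewrite bhz mulr0 addr0.
have [r /= r0 rP] := (@nbhs_ballP R _ z _).1
  (filterI (open_nbhs_nbhs (conj oU Uz)) (filterI nE n1)).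
pose r1 := r / 2; have r10 : 0 < r1 by rewrite divr_gt0.
pose N := [set s : 'rV[R]_p | `|s - z| <= r1].
have cnorm s : {for s, continuous (fun s : 'rV[R]_p => `|s - z|)}.
  have cB : {for s, continuous (fun s : 'rV[R]_p => s - z)}.
    by apply/differentiable_continuous/differentiableB => //; exact: differentiable_cst.
  exact: (@continuous_comp _ _ _ (fun s : 'rV[R]_p => s - z) (fun x => `|x|) s cB (@norm_continuous R _ (s - z))).
have NP s : N s -> [/\ U s,
    0 < elliptic (a s) (b s) (barrier_grad y z K ^~ s) (fun i j => barrier_hess y z K i j s) &
    0 < 1 + K / 2 * ball_height y z s].
  move=> Ns; have [|Us [Es b1]] := rP s; last by [].
  by rewrite -ball_normE /= distrC (le_lt_trans Ns) // /r1 ltr_pdivrMr // ltr_pMr // ltr1n.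
have cN : compact N by apply: (@compact_le R p (fun s : 'rV[R]_p => `|s - z|) z r1 r1).
have Nz : N z by rewrite /N /= subrr normr0 ltW.
have ch s : N s -> {for s, continuous h}.
  by move=> /NP[Us _ _]; apply/differentiable_continuous/hd.
have cbh s : {for s, continuous (ball_height y z)}.
  exact/differentiable_continuous/differentiable_ball_height.
have cbar s : {for s, continuous (barrier y z K)}.
  exact/differentiable_continuous/differentiable_barrier.
(* h is uniformly below m on the part of the sphere where the barrier may be positive *)
pose S := N `&` [set s | r1 <= `|s - z|] `&` [set s | 0 <= ball_height y z s].
have [e e0 eP] : exists2 e : R, 0 < e & forall s, S s -> h s + e < m.
  have [S0|/set0P S0] := eqVneq S set0; first by exists 1 => // s; rewrite S0.
  have cS : compact S.
    apply: compact_closedI; last first.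
      apply: (@closed_comp _ _ (ball_height y z) [set x | 0 <= x]);
        [by move=> s _; exact: cbh|exact: closed_ge].
    apply: compact_closedI => //.
    by apply: (@closed_comp _ _ (fun s => `|s - z|) [set x | r1 <= x]); [move=> s _; exact: cnorm|exact: closed_ge].
  have [s0 s0S s0max] :
      exists2 c, c \in S & forall t, t \in S -> h t <= h c.
    apply: compact_EVT_max => //; apply: continuous_in_subspaceT => s; rewrite inE => -[[Ns _] _].
    exact: ch.
  move: s0S; rewrite inE => -[[Ns0 s0r] s0h].
  have lt0 : h s0 < m.
    apply: hlt; move: s0h; rewrite /= /ball_height => s0h.
    have : 0 < sqdist z s0.
      apply: sqdist_gt0; apply: contraTneq s0r => ->.
      by rewrite /= subrr normr0 -ltNge.
    lra.
  exists ((m - h s0) / 2); first by rewrite divr_gt0 // subr_gt0.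
  move=> s /mem_set /s0max; lra.
have [s1 /set_mem Ns1 s1max] :
    exists2 c, c \in N & forall t, t \in N -> barrier y z K t <= barrier y z K c.
  apply: compact_EVT_max => //; first by exists z.
  by apply: continuous_in_subspaceT => s _; exact: cbar.
pose B := barrier y z K s1.
have bz : barrier y z K z = 0 by rewrite /barrier bhz mul0r.
have B0 : 0 <= B by rewrite -bz; apply: s1max; rewrite inE.
(* the multiple of the barrier that moves h by at most e *)
pose t := e / (B + 1).
have t0 : 0 < t by rewrite divr_gt0 // ltr_pwDr.
have tB s : N s -> t * barrier y z K s <= e.
  move=> Ns; apply: (@le_trans _ _ (t * (B + 1))); last by rewrite /t divfK // lt0r_neq0 // ltr_pwDr.
  rewrite (ler_wpM2l (ltW t0)) //; have := s1max s (mem_set Ns); rewrite -/B; lra.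
pose k s := h s + t * barrier y z K s.
have [q /set_mem Nq qmax] : exists2 c, c \in N & forall s, s \in N -> k s <= k c.
  apply: compact_EVT_max => //; first by exists z.
  apply: continuous_in_subspaceT => s /set_mem Ns.
  exact: (continuous_add_at (ch s Ns) (continuous_mul_at (@continuous_cst_at R _ t s) (cbar s))).
have kq : m <= k q by have := qmax z (mem_set Nz); rewrite /k bz mulr0 addr0 hz.
have qint : `|q - z| < r1.
  rewrite ltNge; apply/negP => qr; have [Uq _ b1] := NP q Nq.
  have [hge|hlt0] := leP 0 (ball_height y z q).
    have := eP q (conj (conj Nq qr) hge); have := tB q Nq; move: kq; rewrite /k; lra.
  have : t * barrier y z K q < 0 by rewrite pmulr_rlt0 // /barrier pmulr_llt0.
  by move: kq (hm q Uq); rewrite /k; lra.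
pose O := [set s : 'rV[R]_p | `|s - z| < r1].
have oO : open O.
  by apply: (@open_comp _ _ (fun s => `|s - z|) [set x | x < r1]); [move=> s _; exact: cnorm|exact: open_lt].
have ON s : O s -> N s by exact: ltW.
have [Uq Eq _] := NP q Nq.
have db s := differentiable_barrier y z K s.
have dbg j s := differentiable_barrier_grad y z K j s.
have : elliptic (a q) (b q) (fun j => d j q + t * barrier_grad y z K j q)
   (fun i j => 'D_(delta_mx 0 i) (fun s => d j s + t * barrier_grad y z K j s) q) <= 0.
  apply: (@elliptic_max R p O q k (fun j s => d j s + t * barrier_grad y z K j s) _ _ oO qint (apos Uq)).
  - move=> s /ON/NP[Us _ _]; apply: differentiableD; first exact: hd.
    by exact: differentiable_scale.
  - move=> s j /ON/NP[Us _ _]; rewrite -hD // -derive_barrier.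
    have dm := is_derive_scale t (is_derive_differentiable (delta_mx 0 j) (db s)).
    by have [_ ->] := is_deriveD (is_derive_differentiable (delta_mx 0 j) (hd Us)) dm.
  - move=> j; apply: differentiableD; first exact: dd.
    by exact: differentiable_scale.
  - by move=> s /ON Ns; apply: qmax; rewrite inE.
have -> : elliptic (a q) (b q) (fun j => d j q + t * barrier_grad y z K j q)
   (fun i j => 'D_(delta_mx 0 i) (fun s => d j s + t * barrier_grad y z K j s) q) =
   elliptic (a q) (b q) (d^~ q) (fun i j => 'D_(delta_mx 0 i) (d j) q) +
   t * elliptic (a q) (b q) (barrier_grad y z K ^~ q) (fun i j => barrier_hess y z K i j q).
  have D i j : 'D_(delta_mx 0 i) (fun s => d j s + t * barrier_grad y z K j s) q =
     'D_(delta_mx 0 i) (d j) q + t * barrier_hess y z K i j q.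
    have dm := is_derive_scale t (is_derive_barrier_grad y z K i j q).
    by have [_ ->] := is_deriveD (is_derive_differentiable (delta_mx 0 i) (dd j Uq)) dm.
  rewrite /elliptic mulrDr addrACA; congr (_ + _).
    rewrite mulr_sumr -big_split /=; apply: eq_bigr => i _.
    rewrite mulr_sumr -big_split /=; apply: eq_bigr => j _; rewrite D; ring.
  rewrite mulr_sumr -big_split /=; apply: eq_bigr => j _; ring.
rewrite leNgt ltr_wpDl //; first exact: subsolution.
by rewrite mulr_gt0.
Qed.

(** If [h] were below its maximum at some [y] close to [w], the ball around [y]
    growing until it meets the maximum set would be a touching ball. *)
Lemma strong_maximum_principle w : U w -> (forall s, U s -> h s <= h w) ->
  \forall s \near w, h s = h w.
Proof.
move=> Uw hw.
have [r /= r0 rU] := (@nbhs_ballP R _ w _).1 (open_nbhs_nbhs (conj oU Uw)).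
have r20 : 0 < r / 2 by rewrite divr_gt0.
have n1 : \forall y \near w, sqdist w y < (r / 2) ^+ 2.
  by apply: (cvgr_lt _ (continuous_sqdist (y := w) (s := w))); rewrite sqdistxx exprn_gt0.
apply: filterS n1 => y yw.
have dy : `|w - y| < r / 2 by apply: norm_sqdist => //; rewrite sqdistC.
pose C := [set s | sqdist y s <= sqdist y w].
have CU s : C s -> U s.
  move=> Cs; apply: rU; rewrite -ball_normE /= -(subrKA y).
  rewrite (le_lt_trans (ler_normD _ _)) // [ltRHS]splitr ltrD // distrC.
  by apply: norm_sqdist => //; rewrite (le_lt_trans Cs) // sqdistC.
have Cy : C y by rewrite /C /= sqdistxx sqdist_ge0.
apply/eqP; rewrite eq_le (hw y (CU y Cy)) /= leNgt; apply/negP => hy.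
have cC : compact C.
  apply: (@compact_le R p (sqdist y) y _ (r / 2)); first by move=> s; exact: continuous_sqdist.
  by move=> s Cs; apply/ltW/norm_sqdist => //; rewrite (le_lt_trans Cs) // sqdistC.
pose A := C `&` [set s | h s = h w].
have clC : closed C.
  by apply: (@closed_comp _ _ (sqdist y) [set x | x <= sqdist y w]); [move=> s _; exact: continuous_sqdist|exact: closed_le].
have clA : closed A.
  rewrite closedE => s ns.
  have Cs : C s.
    move: clC; rewrite closedE; apply => ns'; apply: ns.
    by apply: filterS ns' => x nCx [].
  split=> //; apply: contrapT => hsw; apply: ns.
  have hs : h s < h w by rewrite lt_neqAle (hw _ (CU _ Cs)) andbT; apply/eqP.
  have hc : {for s, continuous h} by apply/differentiable_continuous/hd/CU.
  by apply: filterS (cvgr_lt _ hc _ hs) => x hx [_ /= E]; rewrite E ltxx in hx.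
have cA : compact A by apply: subclosed_compact clA cC _ => s [].
(* the touching point: a maximum point of h closest to y *)
have [z /set_mem[Cz hz] zmin] : exists2 c, c \in A & forall t, t \in A -> sqdist y c <= sqdist y t.
  apply: compact_EVT_min => //; first by exists w; split=> //; rewrite /C /= lexx.
  by apply: continuous_in_subspaceT => s _; exact: continuous_sqdist.
apply: (@no_touching_ball y z (h w)) => //; first exact: CU.
  by apply: contraTneq hy => <-; rewrite hz ltxx.
move=> s sz; have Cs : C s by rewrite /C /= (le_trans (ltW sz)).
rewrite lt_neqAle (hw s (CU s Cs)) andbT; apply/eqP => hs.
by have := zmin s (mem_set (conj Cs hs)); rewrite leNgt sz.
Qed.

End StrongMaximumPrinciple.

(** * Calibrations in a chart *)

Section Fermat.
Variable R : realType.

(** The difference quotients on the two sides of the minimum have opposite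
    signs. Differentiability is assumed at the minimum only. *)
Lemma is_derive_local_min (f : R -> R) (df : R) : is_derive (0 : R) 1 f df ->
  (\forall t \near (0 : R), f 0 <= f t) -> df = 0.
Proof.
move=> fd fmin; apply/eqP; apply: contraT => df0.
have n0 : 0 < `|df| by rewrite normr_gt0.
have [dv de] := fd; have := dv; rewrite /derivable => /(@cvgrPdist_lt _ _ _ _ _)/(_ _ n0).
rewrite -[lim _]/('D_1 f 0) de near_withinE => nq.
have [r /= r0 rP] := (@nbhs_ballP R R _ _).1 (filterI nq fmin).
have key t : 0 < `|t| -> `|t| < r -> 0 < df * (t^-1 * (f t - f 0)) /\ f 0 <= f t.
  move=> t0 tr; have [|/= q m] := rP t; first by rewrite /ball /= sub0r normrN.
  split=> //; rewrite normr_gt0 in t0; have := q t0.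
  rewrite addr0 [t *: 1]mulr1 -[_ *: _]/(_ * _); case: (ltrP 0 df) => [d0|d0].
    rewrite (gtr0_norm d0) => /ltr_normlP[_]; rewrite ltrBlDr ltrDl => ?.
    by rewrite mulr_gt0.
  have {}d0 : df < 0 by rewrite lt_neqAle df0.
  rewrite (ltr0_norm d0) => /ltr_normlP[]; rewrite opprB ltrBlDr addNr => ? _.
  by rewrite nmulr_rgt0.
have r2 : 0 < r / 2 by rewrite divr_gt0.
have rr : r / 2 < r by rewrite ltr_pdivrMr // ltr_pMr // ltr1n.
have [] := key (r / 2); rewrite ?gtr0_norm // => k1 m1.
have [] := key (- (r / 2)); rewrite ?normrN ?gtr0_norm // => k2 m2.
have s1 : 0 <= (r / 2)^-1 * (f (r / 2) - f 0).
  by rewrite mulr_ge0 ?invr_ge0 ?subr_ge0 // ltW.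
have s2 : (- (r / 2))^-1 * (f (- (r / 2)) - f 0) <= 0.
  by rewrite mulr_le0_ge0 ?subr_ge0 // invrN oppr_le0 invr_ge0 ltW.
case: (ltrP 0 df) => d0.
  by move: k2; rewrite ltNge mulr_ge0_le0 // ltW.
by move: k1; rewrite ltNge mulr_le0_ge0.
Qed.

End Fermat.

Lemma is_derive_mulmx (R : realType) (V : normedModType R) m n q (x v : V)
    (A : V -> 'M[R]_(m, n)) (B : V -> 'M[R]_(n, q)) (dA : 'M[R]_(m, n)) (dB : 'M[R]_(n, q)) i j :
  (forall i j, is_derive x v (fun y => A y i j) (dA i j)) ->
  (forall i j, is_derive x v (fun y => B y i j) (dB i j)) ->
  is_derive x v (fun y => (A y *m B y) i j) ((A x *m dB + dA *m B x) i j).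
Proof.
move=> Ad Bd; under eq_fun do rewrite mxE.
have := is_derive_sum_fun (index_enum 'I_n) xpredT (fun k => is_derive_mul (Ad i k) (Bd k j)).
rewrite big_split /= !mxE => H; apply: is_derive_eq H _; congr (_ + _).
by apply: eq_bigr => k _; rewrite mulrC.
Qed.

(** Oriented changes of frame are matrices of positive determinant, whereas
    homogeneity is used one row at a time; this passes from one to the other. *)
Lemma set_row_diag (R : realType) p n (i : 'I_p) (c : R) (W : 'M[R]_(p, n)) :
  exists2 A : 'M[R]_p, \det A = c & set_row i (c *: row i W) W = A *m W.
Proof.
exists (diag_mx (\row_j (if j == i then c else 1))).
  rewrite det_diag (bigD1 i) //= mxE eqxx big1 ?mulr1 // => j ji.
  by rewrite mxE (negbTE ji).
apply/matrixP => j k; rewrite mul_diag_mx set_rowE !mxE.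
by case: eqP => [->|_] //; rewrite mul1r.
Qed.

Lemma sqnorm_mul (R : realType) n p (g : 'M[R]_n) (A : 'M[R]_p) (W : 'M[R]_(p, n)) :
  sqnorm_simple g (A *m W) = \det A ^+ 2 * sqnorm_simple g W.
Proof.
rewrite /sqnorm_simple.
have -> : A *m W *m g *m (A *m W)^T = A *m (W *m g *m W^T) *m A^T.
  by rewrite trmx_mul !mulmxA.
by rewrite !det_mulmx det_tr; ring.
Qed.

Section LocalCalibration.
Variables (R : realType) (n p : nat) (O : set 'rV[R]_n).
Variables (G : 'rV[R]_n -> 'M[R]_n) (w : 'rV[R]_n -> 'M[R]_(p, n) -> R).
Implicit Types (u v : 'rV[R]_n) (W : 'M[R]_(p, n)).
Hypothesis oO : open O.
Hypothesis p_gt0 : (0 < p)%N.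
Hypothesis G_smooth : smooth_on O G.
Hypothesis G_posdef : forall u, O u -> posdef (G u).
Hypothesis w_smooth : forall W, smooth_on O (w^~ W).
Hypothesis w_multilinear : forall u, O u -> multilinear (w u).
Hypothesis w_alternate : forall u, O u -> alternate (w u).
Hypothesis w_closed : forall u (W : 'M[R]_(p.+1, n)), O u -> exterior_derivative w u W = 0.
Hypothesis w_comass : forall u W, O u -> sqnorm_simple (G u) W = 1 -> w u W <= 1.

(** Scaling one row to reach unit volume extends the comass bound to all
    nondegenerate frames; the two signs of the factor bound the absolute value. *)
Lemma comass_sqr u W : O u -> 0 < sqnorm_simple (G u) W ->
  w u W ^+ 2 <= sqnorm_simple (G u) W.
Proof.
move=> Ou; set D := sqnorm_simple _ _ => D0.
have wm := w_multilinear Ou; pose i0 := Ordinal p_gt0.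
have bound (c : R) : c ^+ 2 * D = 1 -> c * w u W <= 1.
  move=> cD; have [A dA E] := set_row_diag i0 c W.
  rewrite -{1}[W](set_row_id i0) -(multilinearZ wm).
  by apply: w_comass; rewrite // E sqnorm_mul dA.
have sD : 0 < Num.sqrt D by rewrite sqrtr_gt0.
have sD2 : Num.sqrt D ^+ 2 = D by rewrite sqr_sqrtr // ltW.
have D1 : ((Num.sqrt D)^-1) ^+ 2 * D = 1 by rewrite exprVn sD2 mulVf // lt0r_neq0.
have b1 := bound _ D1; have := bound (- (Num.sqrt D)^-1); rewrite sqrrN => /(_ D1) b2.
have x1 : w u W <= Num.sqrt D by rewrite -[leRHS]mulr1 -ler_pdivrMl.
have x2 : - w u W <= Num.sqrt D by rewrite -[leRHS]mulr1 -ler_pdivrMl // mulrN -mulNr.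
rewrite -sD2 -subr_ge0 subr_sqr mulr_ge0 //; lra.
Qed.

Lemma G_differentiable u : O u -> differentiable G u.
Proof. by have [+ _] := G_smooth 1; exact. Qed.

Lemma w_differentiable W u : O u -> differentiable (w^~ W) u.
Proof. by have [+ _] := w_smooth W 1; exact. Qed.

Lemma near_domain (V : normedModType R) (c : V -> 'rV[R]_n) (x : V) :
  {for x, continuous c} -> O (c x) -> \forall y \near x, O (c y).
Proof. by move=> cc Ox; apply: cc; exact: (open_nbhs_nbhs (conj oO Ox)). Qed.

(** The squared volume minus the square of the calibration is nonnegative by
    [comass_sqr] and vanishes at [(u, W)], so it is stationary there under any
    simultaneous variation of the base point and of the frame. *)
Lemma first_variation u W v (dW : 'M[R]_(p, n)) : O u ->
  0 < w u W -> w u W ^+ 2 = sqnorm_simple (G u) W ->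
  2 * w u W * ('D_v (w^~ W) u + \sum_i w u (set_row i (row i dW) W)) =
  \tr ((W *m G u *m dW^T + (W *m 'D_v G u + dW *m G u) *m W^T)
       *m \adj (W *m G u *m W^T)).
Proof.
move=> Ou w0 wD.
pose c (t : R) := t *: v + u; pose Wt (t : R) := W + t *: dW.
have c0 : c 0 = u by rewrite /c scale0r add0r.
have W0 : Wt 0 = W by rewrite /Wt scale0r addr0.
have line (f : 'rV[R]_n -> R) : differentiable f u ->
    is_derive (0 : R) 1 (fun t => f (c t)) ('D_v f u).
  by move=> fd; apply: is_derive_line; rewrite -/(c 0) c0; exact: is_derive_differentiable.
have Wd i k : is_derive (0 : R) 1 (fun t => Wt t i k) (dW i k).
  under eq_fun do rewrite !mxE mulrC.
  have := is_deriveD (is_derive_cst (W i k) (0 : R) 1) (is_derive_scale (dW i k) (is_derive_id (0 : R) 1)).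
  by rewrite mulr1 add0r.
have Gd i k : is_derive (0 : R) 1 (fun t => G (c t) i k) (('D_v G u) i k).
  rewrite -derive_entry; last exact: G_differentiable.
  by apply: (line (fun y => G y i k)); apply: differentiable_entry; exact: G_differentiable.
have gd i k : is_derive (0 : R) 1 (fun t => (Wt t *m G (c t) *m (Wt t)^T) i k)
    ((W *m G u *m dW^T + (W *m 'D_v G u + dW *m G u) *m W^T) i k).
  have WTd a b : is_derive (0 : R) 1 (fun t => (Wt t)^T a b) (dW^T a b).
    by under eq_fun do rewrite mxE; rewrite mxE.
  have := is_derive_mulmx i k (fun a b => is_derive_mulmx a b Wd Gd) WTd.
  by rewrite W0 c0.
have cc : {for 0, continuous c}.
  apply: cvgD; last exact: cvg_cst.
  by apply: cvgZ; [exact: cvg_id|exact: cvg_cst].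
have nO : \forall t \near (0 : R), O (c t) by apply: near_domain => //; rewrite c0.
have wd : is_derive (0 : R) 1 (fun t => w (c t) (Wt t))
    ('D_v (w^~ W) u + \sum_i w u (set_row i (row i dW) W)).
  have := @is_derive_multilinear R R p n (0 : R) (1 : R) (fun t : R => w (c t)) (fun W => 'D_v (w^~ W) u) _ _ Wt dW Wd.
  rewrite W0 c0; apply; last by move=> W'; apply: line; exact: w_differentiable.
  by apply: filterS nO => t; exact: w_multilinear.
have Dd := is_derive_det gd; rewrite W0 c0 in Dd.
have Ed := is_deriveB Dd (is_derive_mul wd wd).
have E0 : \det (W *m G u *m W^T) = w u W ^+ 2 by rewrite wD.
have H := is_derive_local_min Ed.
suff /H/eqP : \forall t \near (0 : R),
    \det (Wt 0 *m G (c 0) *m (Wt 0)^T) - w (c 0) (Wt 0) * w (c 0) (Wt 0) <=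
    \det (Wt t *m G (c t) *m (Wt t)^T) - w (c t) (Wt t) * w (c t) (Wt t).
  by rewrite W0 c0 subr_eq0 => /eqP ->; ring.
rewrite W0 c0 E0 expr2 subrr.
have cD : {for 0, continuous (fun t => \det (Wt t *m G (c t) *m (Wt t)^T))}.
  by apply/differentiable_continuous/derivable1_diffP; have [] := Dd.
have nD : \forall t \near (0 : R), 0 < \det (Wt t *m G (c t) *m (Wt t)^T).
  by apply: (cvgr_gt _ cD); rewrite W0 c0 E0 exprn_gt0.
near=> t; rewrite subr_ge0 -expr2.
by apply: comass_sqr; near: t.
Unshelve. all: by end_near. Qed.

Section CalibratedFrame.
Variables (u : 'rV[R]_n) (W : 'M[R]_(p, n)).
Hypothesis Ou : O u.
Hypothesis w_pos : 0 < w u W.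
Hypothesis w_attained : w u W ^+ 2 = sqnorm_simple (G u) W.
Let A := \adj (W *m G u *m W^T).

Let GT : (G u)^T = G u. Proof. exact: (G_posdef Ou).1. Qed.

Lemma gram_adj_sym : A^T = A.
Proof. by rewrite /A trmx_adj !trmx_mul trmxK GT mulmxA. Qed.

Lemma mxtrace_sym_adj (B : 'M[R]_p) : \tr ((B + B^T) *m A) = 2 * \tr (B *m A).
Proof.
rewrite mulmxDl mxtraceD -[X in _ + X]mxtrace_tr trmx_mul trmxK gram_adj_sym.
by rewrite mxtrace_mulC; ring.
Qed.

(** First cousin principle: the variation of the calibration depends only on
    the tangential part of the variation of the frame. *)
Lemma frame_variation (dW : 'M[R]_(p, n)) :
  w u W * (\sum_i w u (set_row i (row i dW) W)) = \tr (dW *m G u *m W^T *m A).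
Proof.
have := first_variation 0 dW Ou w_pos w_attained.
rewrite !derive0 add0r mulmx0 add0r addrC -/A.
have -> : W *m G u *m dW^T = (dW *m G u *m W^T)^T by rewrite !trmx_mul trmxK GT mulmxA.
rewrite mxtrace_sym_adj -mulrA => H; apply: (mulfI _ H).
by rewrite pnatr_eq0.
Qed.

Lemma base_point_variation v :
  2 * w u W * 'D_v (w^~ W) u = \tr (W *m 'D_v G u *m W^T *m A).
Proof.
have := first_variation v 0 Ou w_pos w_attained.
rewrite big1 ?addr0; last by move=> i _; rewrite row0 multilinear0 //; exact: w_multilinear.
by rewrite trmx0 mulmx0 add0r mul0mx addr0.
Qed.

Lemma set_row_variation i (y : 'rV[R]_n) :
  w u W * w u (set_row i y W) = \sum_j A i j * (y *m G u *m (row j W)^T) 0 0.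
Proof.
have := frame_variation (set_row i y 0).
rewrite (bigD1 i) //= big1 ?addr0 => [|j ji]; last first.
  by rewrite row_set_row (negbTE ji) row0 multilinear0 //; exact: w_multilinear.
rewrite row_set_row eqxx => ->.
rewrite /mxtrace (bigD1 i) //= [X in _ + X]big1 ?addr0 => [|j ji]; last first.
  have -> : (set_row i y 0 *m G u *m W^T *m A) j j = row j (set_row i y 0 *m G u *m W^T *m A) 0 j.
    by rewrite [RHS]mxE.
  by rewrite !row_mul row_set_row (negbTE ji) row0 !mul0mx mxE.
rewrite mxE; apply: eq_bigr => j _.
have -> : (set_row i y 0 *m G u *m W^T) i j = row i (set_row i y 0 *m G u *m W^T) 0 j.
  by rewrite [RHS]mxE.
have -> : A j i = A i j by rewrite -[in LHS]gram_adj_sym [LHS]mxE.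
rewrite !row_mul row_set_row eqxx mulrC; congr (_ * _).
by rewrite !mxE; apply: eq_bigr => k _; rewrite !mxE.
Qed.

(** The matrix of [v |-> Gamma(v, y)]. *)
Definition christoffel_mx (y : 'rV[R]_n) : 'M[R]_n :=
  \matrix_(i, k) \sum_j christoffel G u i j k * y 0 j.

(** The connection is metric: symmetrizing the lowered Christoffel symbols
    leaves one derivative of the metric. *)
Lemma christoffel_mx_metric (y : 'rV[R]_n) :
  christoffel_mx y *m G u + (christoffel_mx y *m G u)^T = 'D_y G u.
Proof.
have sG x : O x -> (G x)^T = G x by move=> Ox; exact: (G_posdef Ox).1.
have uG : G u \in unitmx by exact: posdef_unit (G_posdef Ou).
have lower i m : (christoffel_mx y *m G u) i m =
    \sum_j y 0 j * \sum_l christoffel G u i j l * G u m l.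
  rewrite mxE; under eq_bigr do rewrite mxE mulr_suml.
  rewrite exchange_big; apply: eq_bigr => j _; rewrite mulr_sumr.
  apply: eq_bigr => l _; have -> : G u l m = G u m l by rewrite -[in LHS]GT mxE.
  ring.
apply/matrixP => i m; rewrite mxE [X in _ + X]mxE !lower -big_split /=.
rewrite -derive_entry; last exact: G_differentiable.
rewrite derive_rV; last by apply: differentiable_entry; exact: G_differentiable.
apply: eq_bigr => j _; rewrite !christoffel_lower // -/(partial_at j (fun x => G x i m) u).
rewrite -mulrDr (partial_metricC m j i oO sG Ou) (partial_metricC j i m oO sG Ou).
by rewrite (partial_metricC m i j oO sG Ou); congr (_ * _); lra.
Qed.

(** Both sides measure the change of volume of [W] caused by the derivative of
    the metric along [y]. *)
Lemma christoffel_variation (y : 'rV[R]_n) :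
  \sum_i w u (set_row i (row i (W *m christoffel_mx y)) W) = 'D_y (w^~ W) u.
Proof.
have w2 : 2 * w u W != 0 by rewrite mulf_neq0 ?pnatr_eq0 // lt0r_neq0.
apply: (mulfI w2); rewrite base_point_variation -mulrA frame_variation -mxtrace_sym_adj.
rewrite -christoffel_mx_metric; congr (\tr (_ *m A)).
by rewrite mulmxDr mulmxDl !trmx_mul trmxK !mulmxA.
Qed.

(** Closedness of the calibration on the [p + 1] vectors [y] and the rows of
    [W]. *)
Lemma closed_contraction (y : 'rV[R]_n) :
  'D_y (w^~ W) u = \sum_i 'D_(row i W) (fun x => w x (set_row i y W)) u.
Proof.
have := w_closed (col_mx y W : 'M[R]_(p.+1, n)) Ou.
rewrite /exterior_derivative big_ord_recl expr0 mul1r.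
have -> : row ord0 (col_mx y W : 'M[R]_(p.+1, n)) = y.
  apply/rowP => k; rewrite !mxE; case: splitP => [m _|m /= E]; first by rewrite ord1.
  by move: E; rewrite add1n.
have -> : row' ord0 (col_mx y W : 'M[R]_(p.+1, n)) = W.
  apply/matrixP => i k; rewrite !mxE; case: splitP => m /= E.
    by move: E; rewrite ord1 /bump add1n.
  by congr (W _ _); apply: val_inj; move: E; rewrite /bump /= add1n add1n => -[].
move=> /eqP; rewrite addr_eq0 => /eqP ->; rewrite -sumrN; apply: eq_bigr => i _.
have -> : row (lift ord0 i) (col_mx y W : 'M[R]_(p.+1, n)) = row i W.
  apply/rowP => k; rewrite !mxE; case: splitP => m /= E.
    by move: E; rewrite ord1 /bump /= add1n.
  by congr (W _ _); apply: val_inj; move: E; rewrite /bump /= add1n add1n => -[].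
have wd := w_differentiable (set_row i y W) Ou.
have [_ ds] := is_derive_scale ((-1) ^+ i) (is_derive_differentiable (row i W) wd).
rewrite (@near_eq_derive _ _ _ _ (fun x => (-1) ^+ i * w x (set_row i y W))).
  by rewrite ds /= /bump add1n exprS mulN1r mulNr opprK mulrA -exprMn mulrNN mulr1 expr1n mul1r.
have := open_nbhs_nbhs (conj oO Ou); apply: filterS => x Ox.
by rewrite alternate_row' //; [exact: w_multilinear|exact: w_alternate].
Qed.

(** Metric compatibility turns the Christoffel part of the phi-Hessian into the
    derivative of the calibration along the gradient. What remains is the Lie
    derivative of the calibration along the gradient, free of the connection. *)
Lemma phi_hessian_frame (f : 'rV[R]_n -> R) :
  phi_hessian G w f u W =
  \sum_i (w u (set_row i ('D_(row i W) (gradient G f) u) W)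
          + 'D_(row i W) (fun x => w x (set_row i (gradient G f u) W)) u).
Proof.
rewrite big_split /= -closed_contraction -christoffel_variation -big_split /=.
apply: eq_bigr => i _; rewrite -(multilinearD (w_multilinear Ou)).
congr (w u (set_row i _ W)); rewrite /covariant_derivative; congr (_ + _).
apply/rowP => k; rewrite row_mul !mxE; apply: eq_bigr => a _.
rewrite !mxE mulr_sumr; apply: eq_bigr => b _; ring.
Qed.

End CalibratedFrame.

(** * Calibrated patches *)

Section Gradient.
Variable f : 'rV[R]_n -> R.
Hypothesis f_smooth : smooth_on O f.

(** On the domain the inverse of the metric is the adjugate over the
    determinant, an expression whose derivatives exist. *)
Lemma gradient_entry k : exists2 g : 'rV[R]_n -> R,
  (forall x, O x -> differentiable g x) & (forall x, O x -> gradient G f x 0 k = g x).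
Proof.
exists (fun x => (\det (G x))^-1 * \sum_l \adj (G x) k l * 'D_(delta_mx 0 l) f x).
  move=> x Ox; have CG i j := @Ck1_entry _ _ _ oO _ _ G i j (G_smooth 1).
  apply: differentiable_mul.
    apply: differentiableV; last by rewrite lt0r_neq0 // posdef_det //; exact: G_posdef.
    by have [+ _] := @Ck1_det _ _ _ oO _ G CG; exact.
  apply: differentiable_sum_fun => l; apply: differentiable_mul.
    by have [+ _] := @Ck1_adj _ _ _ oO _ G k l CG; exact.
  by have [_ /(_ (delta_mx 0 l))[+ _]] := f_smooth 2; exact.
move=> x Ox; rewrite mxE mulr_sumr; apply: eq_bigr => l _.
by rewrite /invmx posdef_unit ?mxE ?mulrA //; exact: G_posdef.
Qed.

Lemma gradient_entry_near k (g : 'rV[R]_n -> R) u :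
  (forall x, O x -> gradient G f x 0 k = g x) -> O u ->
  \forall x \near u, g x = gradient G f x 0 k.
Proof.
move=> gE Ou; have := open_nbhs_nbhs (conj oO Ou).
by apply: filterS => x Ox; rewrite gE.
Qed.

Lemma derive_gradient_entry u v k : O u ->
  ('D_v (gradient G f) u) 0 k = 'D_v (fun x => gradient G f x 0 k) u.
Proof.
move=> Ou; rewrite derive_mx ?mxE //; apply/derivable_mxP => i j; rewrite [i]ord1.
have [g gd gE] := gradient_entry j.
by apply: near_eq_derivable (gradient_entry_near gE Ou) _; apply: diff_derivable; exact: gd.
Qed.

Lemma covariant_derivative_gradientZ u v (a : R) : O u ->
  covariant_derivative G (a *: v) (gradient G f) u =
  a *: covariant_derivative G v (gradient G f) u.
Proof.
move=> Ou; rewrite /covariant_derivative scalerDr; congr (_ + _).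
  apply/rowP => k; have [g gd gE] := gradient_entry k.
  have Dg z : ('D_z (gradient G f) u) 0 k = 'd g u z.
    apply: (etrans (derive_gradient_entry z k Ou)).
    rewrite -(near_eq_derive _ (gradient_entry_near gE Ou)) deriveE //; exact: gd.
  apply: (etrans (Dg _)); rewrite linearZ -Dg; apply/esym; exact: mxE.
apply/rowP => k; rewrite !mxE mulr_sumr; apply: eq_bigr => i _.
rewrite mulr_sumr; apply: eq_bigr => j _; rewrite mxE; ring.
Qed.

Lemma phi_hessian_scale u W (i : 'I_p) (a : R) : O u ->
  phi_hessian G w f u (set_row i (a *: row i W) W) = a * phi_hessian G w f u W.
Proof.
move=> Ou; have wm := w_multilinear Ou; rewrite /phi_hessian mulr_sumr.
apply: eq_bigr => j _; rewrite row_set_row; case: (eqVneq j i) => [->|ji].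
  by rewrite set_rowK covariant_derivative_gradientZ // multilinearZ.
by rewrite (set_rowC _ _ _ ji) multilinearZ // -(set_rowC _ _ _ ji) set_row_id.
Qed.

End Gradient.

Section Patch.
Variables (Q : set 'rV[R]_p) (c : 'rV[R]_p -> 'rV[R]_n) (f : 'rV[R]_n -> R).
Implicit Types s : 'rV[R]_p.
Hypothesis oQ : open Q.
Hypothesis c_smooth : smooth_on Q c.
Hypothesis c_dom : forall s, Q s -> O (c s).
Hypothesis f_smooth : smooth_on O f.

(** The Jacobian matrix of the patch, through directional derivatives: the
    smoothness of the patch is stated in terms of these. *)
Definition frame s : 'M[R]_(p, n) := \matrix_(i < p) 'D_(delta_mx 0 i) c s.

Definition gram s : 'M[R]_p := frame s *m G (c s) *m (frame s)^T.

Hypothesis frame_free : forall s, Q s -> row_free (frame s).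
Hypothesis frame_pos : forall s, Q s -> 0 < w (c s) (frame s).
Hypothesis frame_attained : forall s, Q s ->
  w (c s) (frame s) ^+ 2 = sqnorm_simple (G (c s)) (frame s).

Lemma c_differentiable s : Q s -> differentiable c s.
Proof. by have [+ _] := c_smooth 1; exact. Qed.

Lemma Ck1_frame i k : Ck 1 Q (fun s => frame s i k).
Proof.
under eq_fun do rewrite mxE; have [_ +] := c_smooth 2.
by move=> /(_ (delta_mx 0 i)); exact: (@Ck1_entry _ _ _ oQ).
Qed.

Lemma Ck1_gram i j : Ck 1 Q (fun s => gram s i j).
Proof.
have CG a b : Ck 1 Q (fun s => G (c s) a b).
  apply: (@Ck1_comp _ _ _ oQ _ c O (fun x => G x a b)) => //.
  exact: (@Ck1_entry _ _ _ oO _ _ G a b (G_smooth 1)).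
apply: (@Ck1_mul _ _ _ oQ _ _ _ (fun s => frame s *m G (c s)) (fun s => (frame s)^T)).
  by move=> a b; apply: (@Ck1_mul _ _ _ oQ _ _ _ frame (fun s => G (c s))) => //; exact: Ck1_frame.
by move=> a b; under eq_fun do rewrite mxE; exact: Ck1_frame.
Qed.

Lemma posdef_gram s : Q s -> posdef (gram s).
Proof. by move=> Qs; apply: posdef_congr; [exact/G_posdef/c_dom|exact: frame_free]. Qed.

Lemma row_frame i s : row i (frame s) = 'D_(delta_mx 0 i) c s.
Proof. exact: rowK. Qed.

Lemma is_derive_along_patch (g : 'rV[R]_n -> R) i s : Q s -> differentiable g (c s) ->
  is_derive s (delta_mx 0 i) (fun s => g (c s)) ('D_(row i (frame s)) g (c s)).
Proof.
move=> Qs gd; rewrite row_frame; apply: is_derive_comp_fun => //.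
exact: c_differentiable.
Qed.

Definition frame_derive i s : 'M[R]_(p, n) :=
  \matrix_(j, k) 'D_(delta_mx 0 i) (fun s => frame s j k) s.

Lemma frame_derive_sym i j s : Q s -> row j (frame_derive i s) = row i (frame_derive j s).
Proof.
move=> Qs; apply/rowP => k.
have E a b : row b (frame_derive a s) 0 k = 'D_(delta_mx 0 a) (fun s => frame s b k) s.
  by rewrite [LHS]mxE [LHS]mxE.
apply: (etrans (E i j)); apply: (etrans _ (esym (E j i))); clear E.
have [dj cj] := Ck1_frame j k; have [di ci] := Ck1_frame i k.
apply: (@derive_symmetric _ _ (fun s => c s 0 k) _ _ _ _ _ _ oQ Qs) => //.
- by move=> y Qy; apply: differentiable_entry; exact: c_differentiable.
- by move=> y Qy; rewrite derive_entry ?mxE //; exact: c_differentiable.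
- by move=> y Qy; rewrite derive_entry ?mxE //; exact: c_differentiable.
- exact: cj.
- exact: ci.
Qed.

Lemma is_derive_gradient i k s : Q s ->
  is_derive s (delta_mx 0 i) (fun s => gradient G f (c s) 0 k)
    ('D_(row i (frame s)) (gradient G f) (c s) 0 k).
Proof.
move=> Qs; have Ocs := c_dom Qs; set v := row i _.
rewrite derive_gradient_entry //; have [g gd gE] := gradient_entry f_smooth k.
rewrite -(near_eq_derive _ (gradient_entry_near gE Ocs)).
apply: near_eq_is_derive (is_derive_along_patch i Qs (gd _ Ocs)).
have := open_nbhs_nbhs (conj oQ Qs); apply: filterS => y Qy.
by rewrite gE //; exact: c_dom.
Qed.

Definition pullback_derive (j : 'I_p) s : R :=
  \sum_k frame s j k * 'D_(delta_mx 0 k) f (c s).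

Lemma derive_pullback s j : Q s ->
  'D_(delta_mx 0 j) (fun s => f (c s)) s = pullback_derive j s.
Proof.
move=> Qs; have [fd _] := f_smooth 1; have fds := fd _ (c_dom Qs).
have [_ ->] := is_derive_along_patch j Qs fds.
by rewrite derive_rV //; apply: eq_bigr => k _; rewrite mxE.
Qed.

Lemma differentiable_pullback s j : Q s -> differentiable (pullback_derive j) s.
Proof.
move=> Qs; apply: differentiable_sum_fun => k; apply: differentiable_mul.
  by have [+ _] := Ck1_frame j k; exact.
have [_ /(_ (delta_mx 0 k))[fd _]] := f_smooth 2.
apply: (@differentiable_comp _ _ _ _ c ('D_(delta_mx 0 k) f)).
  exact: c_differentiable.
exact/fd/c_dom.
Qed.

(** Up to sign, the components of the (p-1)-form grad f _| phi pulled back to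
    the patch. *)
Definition flux (i : 'I_p) s : R :=
  w (c s) (set_row i (gradient G f (c s)) (frame s)).

(** By the first cousin principle only the tangential part of the gradient
    contributes, which makes the pullback the Hodge dual of the differential of
    the restricted function. *)
Lemma flux_adj i s : Q s ->
  w (c s) (frame s) * flux i s = \sum_j \adj (gram s) i j * pullback_derive j s.
Proof.
move=> Qs; have Ocs := c_dom Qs.
rewrite /flux set_row_variation //; [|exact: frame_pos|exact: frame_attained].
have gp := G_posdef Ocs.
apply: eq_bigr => j _; congr (_ * _).
pose df : 'rV[R]_n := \row_k 'D_(delta_mx 0 k) f (c s).
have -> : gradient G f (c s) = df *m invmx (G (c s)).
  have iT : (invmx (G (c s)))^T = invmx (G (c s)) by rewrite trmx_inv gp.1.
  apply/rowP => k; rewrite !mxE; apply: eq_bigr => l _.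
  by rewrite mxE mulrC -[in LHS]iT mxE.
rewrite mulmxKV ?posdef_unit // mxE; apply: eq_bigr => k _.
by rewrite !mxE mulrC.
Qed.

Definition flux_derive i s : R :=
  'D_(row i (frame s)) (fun x => w x (set_row i (gradient G f (c s)) (frame s))) (c s) +
  \sum_j w (c s) (set_row j
    (row j (set_row i ('D_(row i (frame s)) (gradient G f) (c s)) (frame_derive i s)))
    (set_row i (gradient G f (c s)) (frame s))).

Lemma near_multilinear s : Q s -> \forall y \near s, multilinear (w (c y)).
Proof.
move=> Qs; have := open_nbhs_nbhs (conj oQ Qs).
by apply: filterS => y Qy; exact/w_multilinear/c_dom.
Qed.

Lemma is_derive_calibration i s : Q s -> forall W,
  is_derive s (delta_mx 0 i) (fun y => w (c y) W) ('D_(row i (frame s)) (w^~ W) (c s)).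
Proof.
move=> Qs W; apply: (is_derive_along_patch (g := w^~ W)) => //.
exact/w_differentiable/c_dom.
Qed.

Lemma is_derive_frame i j k s : Q s ->
  is_derive s (delta_mx 0 i) (fun s => frame s j k) (frame_derive i s j k).
Proof.
move=> Qs; rewrite mxE; apply: is_derive_differentiable.
by have [+ _] := Ck1_frame j k; exact.
Qed.

Lemma is_derive_flux i s : Q s -> is_derive s (delta_mx 0 i) (flux i) (flux_derive i s).
Proof.
move=> Qs; apply: (is_derive_multilinear (near_multilinear Qs)
  (is_derive_calibration i Qs)) => j k.
rewrite set_rowE; under eq_fun do rewrite set_rowE.
by case: (j == i); [exact: is_derive_gradient|exact: is_derive_frame].
Qed.

(** The terms that differentiate the frame cancel in pairs, mixed partial
    derivatives being symmetric and the calibration alternate. *)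
Lemma sum_flux_derive s : Q s ->
  \sum_i flux_derive i s = phi_hessian G w f (c s) (frame s).
Proof.
move=> Qs; have Ocs := c_dom Qs.
have wm := w_multilinear Ocs; have wa := w_alternate Ocs.
rewrite phi_hessian_frame //; [|exact: frame_pos|exact: frame_attained].
set Y := gradient G f (c s).
pose T i j := w (c s) (set_row j (row j (frame_derive i s)) (set_row i Y (frame s))).
have TC i j : j != i -> T i j = - T j i.
  move=> ji; rewrite /T (alternate_swap wm wa _ _ _ ji); congr (- _).
  rewrite (set_rowC _ _ _ ji).
  exact: (congr1 (fun r => w (c s) (set_row i r (set_row j Y (frame s))))
    (frame_derive_sym i j Qs)).
have T0 : \sum_i \sum_(j | j != i) T i j = 0.
  have E : \sum_i \sum_(j | j != i) T i j = - \sum_i \sum_(j | j != i) T i j.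
    rewrite [LHS](exchange_big_dep xpredT) //= -sumrN; apply: eq_bigr => j _.
    rewrite -sumrN; apply: eq_big => [i|i]; first by rewrite eq_sym.
    exact: TC.
  lra.
have D i : flux_derive i s = (w (c s) (set_row i ('D_(row i (frame s)) (gradient G f) (c s)) (frame s))
   + 'D_(row i (frame s)) (fun x => w x (set_row i Y (frame s))) (c s)) + \sum_(j | j != i) T i j.
  rewrite /flux_derive (bigD1 i) //= row_set_row eqxx set_rowK addrA -/Y.
  congr (_ + _); first by rewrite addrC.
  by apply: eq_bigr => j ji; rewrite row_set_row (negbTE ji).
by under eq_bigr do rewrite D; rewrite big_split /= T0 addr0.
Qed.

Let det_gram s := \det (gram s).
Let adj_gram i j s := \adj (gram s) i j.

(** The first order coefficients that appear when the divergence of the flux is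
    expanded and multiplied by the volume density. The density is seen through
    its square, the Gram determinant, which is polynomial in known quantities. *)
Definition drift s : 'rV[R]_p :=
  \row_j \sum_i ('D_(delta_mx 0 i) (adj_gram i j) s
    - (2 * det_gram s)^-1 * 'D_(delta_mx 0 i) det_gram s * adj_gram i j s).

Lemma continuous_drift s j : Q s -> {for s, continuous (fun s => drift s 0 j)}.
Proof.
move=> Qs.
apply: (continuous_eq_on oQ (f := fun s => \sum_i ('D_(delta_mx 0 i) (adj_gram i j) s
    - (2 * det_gram s)^-1 * 'D_(delta_mx 0 i) det_gram s * adj_gram i j s))) => //.
  by move=> y _; rewrite [RHS]mxE.
have [Dd Dc] := @Ck1_det _ _ _ oQ _ gram Ck1_gram.
apply: continuous_sum_at => i.
have [Ad Ac] := @Ck1_adj _ _ _ oQ _ gram i j Ck1_gram.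
have cV : {for s, continuous (fun s => (2 * det_gram s)^-1)}.
  have n0 : 2 * det_gram s != 0.
    by rewrite mulf_neq0 ?pnatr_eq0 // lt0r_neq0 // posdef_det //; exact: posdef_gram.
  have cM := continuous_mul_at (@continuous_cst_at R _ 2 s) (differentiable_continuous (Dd s Qs)).
  exact: (cvgV n0 cM).
have c2 := continuous_mul_at (continuous_mul_at cV (Dc (delta_mx 0 i) s Qs))
  (differentiable_continuous (Ad s Qs)).
have c1 := Ac (delta_mx 0 i) s Qs.
exact: (cvgB c1 c2).
Qed.

(** The phi-Hessian on the tangent frame is the divergence of the flux, hence a
    positive multiple of the Laplacian of the restriction: an elliptic operator
    without zeroth order term. *)
Lemma elliptic_phi_hessian s : Q s ->
  elliptic (\adj (gram s)) (drift s) (pullback_derive^~ s)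
    (fun i j => 'D_(delta_mx 0 i) (pullback_derive j) s) =
  w (c s) (frame s) * phi_hessian G w f (c s) (frame s).
Proof.
move=> Qs; have Ocs := c_dom Qs; rewrite -sum_flux_derive //.
have nQ := open_nbhs_nbhs (conj oQ Qs).
have [Dd _] := @Ck1_det _ _ _ oQ _ gram Ck1_gram.
have Ad i j : differentiable (adj_gram i j) s.
  by have [+ _] := @Ck1_adj _ _ _ oQ _ gram i j Ck1_gram; exact.
pose rho y := w (c y) (frame y).
have rho0 : 0 < rho s by exact: frame_pos.
have rhoD y : Q y -> rho y ^+ 2 = det_gram y by exact: frame_attained.
have rho_derivable i : derivable rho s (delta_mx 0 i).
  by have [] := is_derive_multilinear (near_multilinear Qs)
    (is_derive_calibration i Qs) (fun j k => is_derive_frame i j k Qs).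
pose drho i := 'D_(delta_mx 0 i) rho s.
have rhod i : is_derive s (delta_mx 0 i) rho (drho i) by exact: derivableP.
have DD i : 'D_(delta_mx 0 i) det_gram s = 2 * rho s * drho i.
  have [_ E] := is_derive_mul (rhod i) (rhod i).
  rewrite -(@near_eq_derive _ _ _ (fun y => rho y * rho y)) ?E; first by ring.
  by apply: filterS nQ => y Qy; rewrite -expr2 rhoD.
have key i : rho s * flux_derive i s + flux i s * drho i =
    \sum_j (adj_gram i j s * 'D_(delta_mx 0 i) (pullback_derive j) s
            + pullback_derive j s * 'D_(delta_mx 0 i) (adj_gram i j) s).
  have [_ <-] := is_derive_mul (rhod i) (is_derive_flux i Qs).
  have [_ <-] := is_derive_sum_fun (index_enum 'I_p) xpredT (fun j => is_derive_mul
    (is_derive_differentiable (delta_mx 0 i) (Ad i j))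
    (is_derive_differentiable (delta_mx 0 i) (differentiable_pullback j Qs))).
  apply: near_eq_derive; apply: filterS nQ => y Qy; exact: flux_adj.
have F i : (2 * det_gram s)^-1 * 'D_(delta_mx 0 i) det_gram s *
    (\sum_j adj_gram i j s * pullback_derive j s) = flux i s * drho i.
  rewrite -(flux_adj i Qs) -/(rho s) DD -rhoD //; field.
  exact: lt0r_neq0.
rewrite mulr_sumr /elliptic.
transitivity (\sum_i (\sum_j (adj_gram i j s * 'D_(delta_mx 0 i) (pullback_derive j) s
            + pullback_derive j s * 'D_(delta_mx 0 i) (adj_gram i j) s)
   - (2 * det_gram s)^-1 * 'D_(delta_mx 0 i) det_gram s *
    (\sum_j adj_gram i j s * pullback_derive j s))); last first.
  by apply: eq_bigr => i _; rewrite -key F addrK.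
under [in RHS]eq_bigr do rewrite big_split -addrA /=.
rewrite big_split /=; congr (_ + _).
under [in LHS]eq_bigr do rewrite mxE mulr_suml.
rewrite exchange_big; apply: eq_bigr => i _.
rewrite [X in _ - X]mulr_sumr -sumrB; apply: eq_bigr => j _; ring.
Qed.

Lemma calibrated_maximum_principle s0 : Q s0 ->
  (forall s, Q s -> 0 <= phi_hessian G w f (c s) (frame s)) ->
  (forall s, Q s -> f (c s) <= f (c s0)) -> \forall s \near s0, f (c s) = f (c s0).
Proof.
move=> Qs0 Hge fmax.
apply: (@strong_maximum_principle R p Q (fun s => \adj (gram s)) drift (fun s => f (c s))
  pullback_derive) => //.
- by move=> s Qs; apply: posdef_adj; exact: posdef_gram.
- move=> s i j Qs; apply: differentiable_continuous.
  by have [+ _] := @Ck1_adj _ _ _ oQ _ gram i j Ck1_gram; exact.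
- exact: continuous_drift.
- move=> s Qs; have [fd _] := f_smooth 1.
  by apply: differentiable_comp; [exact: c_differentiable|exact/fd/c_dom].
- by move=> s j Qs; exact: derive_pullback.
- by move=> s j Qs; exact: differentiable_pullback.
- move=> s Qs; rewrite elliptic_phi_hessian // mulr_ge0 ?Hge //.
  by apply: ltW; exact: frame_pos.
Qed.

End Patch.

End LocalCalibration.

(** * Plurisubharmonic functions on a compact calibrated submanifold *)

Lemma Ck_subset (R : realType) (V W : normedModType R) (U U' : set V) (f : V -> W) k :
  U' `<=` U -> Ck k U f -> Ck k U' f.
Proof.
move=> sU; elim: k f => [|k IH] f /=; first by move=> fc x /sU; exact: fc.
by move=> [fd fk]; split=> [x /sU|v]; [exact: fd|exact/IH/fk].
Qed.

Section Restriction.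
Variables (R : realType) (n p : nat) (X : calibrated_manifold R n p).
Variables (M : set X) (P : set (parametrized_patch R X p)).
Hypothesis M_phi : phi_submanifold M P.
Implicit Types (a : parametrized_patch R X p) (x y : X) (s : 'rV[R]_p).

Let paramP a : P a -> local_parametrization M a.
Proof. exact: (orientation_param M_phi.1). Qed.

Lemma psh_continuous (f : X -> R) : PSH X f -> continuous f.
Proof.
move=> [f_smooth _] x; have [c cA cx] := atlas_cover x.
have fc : {for cmap c x, continuous (f \o cinv c)}.
  by apply: (f_smooth c cA 0); exists x.
have cc := cmap_continuous cx.
have H : {for x, continuous ((f \o cinv c) \o cmap c)} by exact: continuous_comp cc fc.
have E : ((f \o cinv c) \o cmap c) x = f x by rewrite /= cmapK.
rewrite /prop_for /continuous_at E in H.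
apply: cvg_trans H; apply: near_eq_cvg.
have := open_nbhs_nbhs (conj (cdom_open c) cx).
by apply: filterS => y cy /=; rewrite cmapK.
Qed.

Lemma patch_at_open a (c : chart R X n) (V : set 'rV[R]_p) : P a -> open V ->
  V `<=` pdom a -> open (V `&` patch_at c a).
Proof.
move=> Pa oV Va; rewrite openE => s [Vs [as_ cs]].
have n1 := open_nbhs_nbhs (conj oV Vs).
have n2 := open_nbhs_nbhs (conj (pdom_open (paramP Pa)) as_).
have n3 := pparam_continuous (paramP Pa) as_ (open_nbhs_nbhs (conj (cdom_open c) cs)).
by apply: filterS (filterI n1 (filterI n2 n3)) => r [? [? ?]]; split=> //; split.
Qed.

Section InChart.
Variables (a : parametrized_patch R X p) (c : chart R X n) (s : 'rV[R]_p).
Hypotheses (Pa : P a) (cA : atlas c) (sP : patch_at c a s).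
Let u := cmap c (pparam a s).
Let J := patch_frame c a s.

Lemma cimg_patch : cimg c u.
Proof. by exists (pparam a s) => //; case: sP. Qed.

Lemma metric_posdef v : cimg c v -> posdef (metric c v).
Proof. by move=> cv; split; [exact: (Defs.metric_sym cA cv)|exact: (metric_pos cA cv)]. Qed.

Lemma sqnorm_patch_frame_gt0 : 0 < sqnorm_simple (metric c u) J.
Proof.
apply: posdef_det; apply: posdef_congr; first exact/metric_posdef/cimg_patch.
exact: (pparam_immersion (paramP Pa)).
Qed.

(** The frame is rescaled along a single vector, which is enough for the unit
    volume required of a tangent plane. *)
Lemma unit_phi_frame : exists i : 'I_p, exists2 r : R, 0 < r &
  r ^+ 2 * sqnorm_simple (metric c u) J = 1 /\
  phi_plane c u (set_row i (r *: row i J) J).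
Proof.
have D0 := sqnorm_patch_frame_gt0; set D := sqnorm_simple _ _ in D0 *.
pose i := Ordinal (calibration_degree X).
pose r := (Num.sqrt D)^-1.
have r0 : 0 < r by rewrite invr_gt0 sqrtr_gt0.
have rD : r ^+ 2 * D = 1 by rewrite exprVn sqr_sqrtr ?mulVf ?lt0r_neq0 // ltW.
exists i, r => //; split=> //.
have [A dA ->] := set_row_diag i r J.
apply: (M_phi.2 a c s _ Pa cA sP); split; first by rewrite sqnorm_mul dA.
by exists A => //; rewrite dA.
Qed.

Lemma phi_patch_frame : 0 < phi c u J /\ phi c u J ^+ 2 = sqnorm_simple (metric c u) J.
Proof.
have [i [r r0 [rD [_]]]] := unit_phi_frame.
rewrite multilinearZ ?set_row_id => [phiJ|]; last first.
  exact: phi_multilinear cA cimg_patch.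
have E : phi c u J = r^-1 by rewrite -[RHS]mulr1 -phiJ mulKf // lt0r_neq0.
rewrite E invr_gt0 r0; split=> //.
by rewrite -[RHS]mul1r -[1](mulVf (_ : r ^+ 2 != 0)) ?expf_neq0 ?lt0r_neq0 // -mulrA rD mulr1 exprVn.
Qed.

Lemma phi_hessian_patch_frame (f : X -> R) : PSH X f ->
  0 <= phi_hessian (metric c) (phi c) (f \o cinv c) u J.
Proof.
move=> [f_smooth f_psh]; have [i [r r0 [_ pl]]] := unit_phi_frame.
have := f_psh c u _ cA cimg_patch pl.
rewrite (phi_hessian_scale (@cimg_open _ _ _ c) (metric_smooth cA) metric_posdef _ (f_smooth c cA)).
- by rewrite pmulr_rge0.
- by move=> v cv; exact: phi_multilinear.
- exact: cimg_patch.
Qed.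

End InChart.

(** In a chart, the restriction to the patch is a subsolution of an elliptic
    operator, to which the strong maximum principle applies. *)
Lemma psh_local_maximum (f : X -> R) a (V : set 'rV[R]_p) s0 : PSH X f -> P a ->
  open V -> V `<=` pdom a -> V s0 ->
  (forall s, V s -> f (pparam a s) <= f (pparam a s0)) ->
  \forall s \near s0, f (pparam a s) = f (pparam a s0).
Proof.
move=> f_psh Pa oV Va Vs0 fmax.
have [c cA cs0] := atlas_cover (pparam a s0).
pose Q := V `&` patch_at c a; pose u := cmap c \o pparam a.
have oQ : open Q by exact: patch_at_open.
have Qs0 : Q s0 by split=> //; split=> //; exact: Va.
have fE s : Q s -> (f \o cinv c) (u s) = f (pparam a s).
  by move=> [_ [_ cs]]; rewrite /u /= cmapK.
have u_smooth : smooth_on Q u.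
  move=> k; apply: Ck_subset (pparam_smooth (paramP Pa) cA k).
  by move=> s [].
have uJ s : Q s -> frame u s = patch_frame c a s.
  move=> Qs; apply/row_matrixP => i; rewrite row_frame rowE -deriveEjacobian //.
  by have [+ _] := u_smooth 1; exact.
have dom s : Q s -> cimg c (u s) by move=> [_ sP]; exact: cimg_patch.
have := calibrated_maximum_principle (@cimg_open _ _ _ c) (calibration_degree X)
  (metric_smooth cA) (metric_posdef cA) (fun W => phi_smooth W cA)
  (fun v cv => phi_multilinear cA cv) (fun v cv => phi_alternate cA cv)
  (fun v W cv => phi_closed W cA cv) (fun v W cv => phi_comass cA cv)
  oQ u_smooth dom (f_psh.1 c cA) _ _ _ Qs0 _ _.
move=> H; have {H} : \forall s \near s0, (f \o cinv c) (u s) = (f \o cinv c) (u s0).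
  apply: H.
  - by move=> s Qs; rewrite uJ //; apply: (pparam_immersion (paramP Pa)) => //; case: Qs.
  - by move=> s Qs; rewrite uJ //; case: Qs => _ sP; have [] := phi_patch_frame Pa cA sP.
  - by move=> s Qs; rewrite uJ //; case: Qs => _ sP; have [] := phi_patch_frame Pa cA sP.
  - by move=> s Qs; rewrite uJ //; case: Qs => _ sP; exact: phi_hessian_patch_frame.
  - by move=> s Qs; rewrite !fE //; apply: fmax; case: Qs.
move=> H; apply: filterS (filterI H (open_nbhs_nbhs (conj oQ Qs0))) => s [+ Qs].
by rewrite !fE.
Qed.

Lemma patch_sub a s : P a -> pdom a s -> M (pparam a s).
Proof.
move=> Pa as_; have [U _ E] := pparam_open (paramP Pa) (pdom_open (paramP Pa)) (@subset_refl _ _).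
have : (pparam a @` pdom a) (pparam a s) by exists s.
by rewrite E => -[].
Qed.

(** The image of a ball of parameters is joined to its centre by the images of
    the radii. *)
Lemma ball_component a s0 (r : R) s x : P a -> ball s0 r `<=` pdom a -> ball s0 r s ->
  connected_component M x (pparam a s0) -> connected_component M x (pparam a s).
Proof.
move=> Pa ra rs xC; apply: connected_component_trans xC _.
pose g (t : R) := t *: (s - s0) + s0.
have gr t : `[0, 1]%classic t -> pdom a (g t).
  rewrite /= in_itv /= => /andP[t0 t1]; apply: ra; move: rs; rewrite -!ball_normE /=.
  rewrite /g opprD addrCA subrr addr0 normrN normrZ ger0_norm // [`|s0 - s|]distrC.
  by apply: le_lt_trans; rewrite ler_piMl.
exists ((pparam a \o g) @` `[0, 1]%classic).
  split.
  - by exists 0; [rewrite /= in_itv /= lexx ler01|rewrite /= /g scale0r add0r].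
  - by move=> _ [t t01 <-]; apply: patch_sub => //; exact: gr.
  - apply: connected_continuous_connected; first exact: segment_connected.
    apply: continuous_in_subspaceT => t; rewrite inE => t01.
    apply: continuous_comp; last exact: (pparam_continuous (paramP Pa) (gr t t01)).
    apply: cvgD; last exact: cvg_cst.
    by apply: cvgZ; [exact: cvg_id|exact: cvg_cst].
exists 1; first by rewrite /= in_itv /= lexx ler01.
by rewrite /= /g scale1r subrK.
Qed.

Hypothesis M_compact : compact M.

(** The component is compact, so [f] has a maximum on it; the set where it is
    attained is closed by continuity and open by [psh_local_maximum]. *)
Lemma psh_constant_component (f : X -> R) x y : PSH X f -> M x ->
  connected_component M x y -> f x = f y.
Proof.
move=> f_psh Mx; set C := connected_component M x.
have fc := psh_continuous f_psh.
have Cx : C x by exact: connected_component_refl.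
have clM : closed M by apply: compact_closed => //; exact: manifold_hausdorff.
have clC : closed C by exact: component_closed.
have cC : compact C.
  by apply: subclosed_compact clC M_compact _; exact: connected_component_sub.
have [z /set_mem Cz zmax] : exists2 z, z \in C & forall t, t \in C -> f t <= f z.
  apply: compact_EVT_max => //; first by exists x.
  exact: continuous_subspaceT.
pose E := C `&` [set t | f t = f z].
suff EC : E = C.
  move=> Cy; rewrite -EC in Cx Cy.
  by have [[_ ->] [_ ->]] := conj Cx Cy.
apply: (component_connected (A := M) (x := x)).
- by exists z.
- exists (\bigcup_(U in [set U : set X | open U /\ C `&` U `<=` E]) U).
    by apply: bigcup_open => U [].
  apply/seteqP; split=> [t Et|t [Ct [U [_ UE] Ut]]]; last exact: UE.
  have [Ct ft] := Et; split=> //.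
  have [a Pa [s0 as0 as0t]] := orientation_cover M_phi.1 (connected_component_sub Ct).
  have oD := pdom_open (paramP Pa).
  have [r /= r0 ra] := (@nbhs_ballP R _ s0 _).1 (open_nbhs_nbhs (conj oD as0)).
  have inC s : ball s0 r s -> C (pparam a s).
    by move=> rs; apply: (ball_component Pa ra rs); rewrite as0t.
  have nf := psh_local_maximum f_psh Pa (ball_open s0 r) ra (ballxx s0 r0).
  have {nf} : \forall s \near s0, f (pparam a s) = f (pparam a s0).
    by apply: nf => s /inC Cs; rewrite as0t ft; apply: zmax; rewrite inE.
  move=> nf; have [q /= q0 qP] := (@nbhs_ballP R _ s0 _).1 (filterI nf (nbhsx_ballx s0 _ r0)).
  have qa : ball s0 q `<=` pdom a by move=> s /qP[_ /ra].
  have [U oU UE] := pparam_open (paramP Pa) (ball_open s0 q) qa.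
  exists U; last first.
    have : (pparam a @` ball s0 q) t by exists s0 => //; exact: ballxx.
    by rewrite UE => -[].
  split=> // t' [Ct' Ut']; split=> //=.
  have : (M `&` U) t' by split=> //; exact: connected_component_sub Ct'.
  by rewrite -UE => -[s /qP[+ _] <-]; rewrite as0t ft.
- exists [set t | f t = f z]; last by [].
  by apply: (@closed_comp _ _ f [set v | v = f z]); [move=> t _; exact: fc|exact: closed_eq].
Qed.

End Restriction.

Theorem proposition3p13 (R : realType) (n p : nat)
    (X : calibrated_manifold R n p)
    (X_noncompact : ~ compact [set: X])
    (X_connected : connected [set: X])
    (M : set X) (P : set (parametrized_patch R X p))
    (M_compact : compact M)
    (M_phi : phi_submanifold M P) :
  M `<=` inner_core X.
Proof.
move=> x Mx; have [a Pa [s0 as0 as0x]] := orientation_cover M_phi.1 Mx.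
have aP := orientation_param M_phi.1 Pa.
have [r /= r0 ra] := (@nbhs_ballP R _ s0 _).1 (open_nbhs_nbhs (conj (pdom_open aP) as0)).
have [s rs ss0] : exists2 s, ball s0 r s & s != s0.
  (* the degree being positive, a ball of parameters has several points *)
  pose e : 'rV[R]_p := delta_mx 0 (Ordinal (calibration_degree X)).
  have e0 : e != 0.
    apply/eqP => /matrixP/(_ 0 (Ordinal (calibration_degree X))).
    by rewrite !mxE !eqxx /= => /eqP; rewrite oner_eq0.
  have n0 : 0 < `|e| by rewrite normr_gt0.
  exists (s0 + (r / 2 / `|e|) *: e).
    rewrite -ball_normE /= opprD addrA subrr add0r normrN normrZ ger0_norm; last first.
      by rewrite !divr_ge0 // ltW.
    by rewrite divfK ?lt0r_neq0 // ltr_pdivrMr // ltr_pMr // ltr1n.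
  rewrite -subr_eq0 addrAC subrr add0r scaler_eq0 (negbTE e0) orbF lt0r_neq0 //.
  by rewrite !divr_gt0.
exists (pparam a s).
  move=> E; case/eqP: ss0; apply: (pparam_inj aP); rewrite ?inE //; first exact: ra.
  by rewrite E as0x.
move=> f f_psh; apply: (psh_constant_component M_phi M_compact f_psh Mx).
apply: (ball_component M_phi Pa ra rs); rewrite as0x.
exact: connected_component_refl.
Qed.
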